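(* Let $(\mathcal G,\mathcal S)$ satisfy Axioms (i), (ii), (iii), (vii) and (viii) of the context, and assume that for all $G,H\in\mathcal G$ and all $(D,\phi)\in\mathcal S(G,H)$ one has $k_2(D)=\{1\}$. Set $\mathcal D=\mathcal C^A(\mathcal G,\mathcal S)$ and $\mathcal D^+=\mathcal C^A(\mathcal G,\mathcal S^+)$. Then the constructions $G\mapsto F^+(G)$ and $[U]\mapsto F^+([U])$ described in the context define an $R$-linear functor $-^+:\mathcal F^A_{\mathcal D,R}\to\mathcal F^A_{\mathcal D^+,R}$.
   Context: $A$ is a multiplicatively written abelian group (not necessarily finite), $R$ is a commutative ring with unity, all groups $G,H,K,\dots$ are finite. Pairs. $G^*=\mathrm{Hom}(G,A)$. $\mathcal M(G)$ is the set of pairs $(K,\kappa)$ with $K\le G$, $\kappa\in K^*$; $G$ acts by ${}^g(K,\kappa)=({}^gK,{}^g\kappa)$, ${}^gK=gKg^{-1}$, ${}^g\kappa(gkg^{-1})=\kappa(k)$. For $D\le G\times H$, $p_1,p_2$ are the projections, $k_1(D)=\{g:(g,1)\in D\}$, $k_2(D)=\{h:(1,h)\in D\}$. For $(D,\phi)\in\mathcal M(G\times H)$ put $\phi_1(g)=\phi(g,1)$ on $k_1(D)$ and $\phi_2(h)=\phi(1,h)^{-1}$ on $k_2(D)$. For $V\le H\times K$, $D*V=\{(g,k):\exists h,\ (g,h)\in D,(h,k)\in V\}$; if $(V,\psi)\in\mathcal M(H\times K)$ and $\phi_2=\psi_1$ on $k_2(D)\cap k_1(V)$, then $(\phi*\psi)(g,k)=\phi(g,h)\psi(h,k)$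 (any such $h$) and $(D,\phi)*(V,\psi)=(D*V,\phi*\psi)$. For $K\le H$, $D*K=\{g:\exists k\in K,(g,k)\in D\}$; for $K\le G$, $K*D=\{h:\exists k\in K,(k,h)\in D\}$. If $\lambda\in K^*$ with $K\le H$ and $\phi_2=\lambda$ on $k_2(D)\cap K$, then $\phi*\lambda\in (D*K)^*$ is $(\phi*\lambda)(g)=\phi(g,k)\lambda(k)$ for any $k\in K$ with $(g,k)\in D$. $\Delta(K)=\{(k,k):k\in K\}$, $1$ is the trivial homomorphism. A pair $(D,\phi)$ is regarded as an element of $\mathcal M(G'\times H')$ for any $G',H'$ with $D\le G'\times H'$. Fibered bisets. An $A$-fibered $G$-set is a $(G\times A)$-set with finitely many $A$-orbits on which $A$ acts freely. An $A$-fibered $(G,H)$-biset is an $A$-fibered $(G\times H)$-set, with $gauhb=((g,h^{-1}),ab)u$. For $u$ in such a biset, the stabilizing pair $((G\times H)_u,\phi_u)$ consists of the stabilizer of the $A$-orbit of $u$ and the homomorphism defined by $(g,h)u=\phi_u(g,h)u$. $B^A(G,H)$ is the Grothendieck group under disjoint union, $B^A_R(G,H)=R\otimes_{\mathbb Z} B^A(G,H)$. $\left[\frac{G\times H}{D,\phi}\right]$ is the class of $(G\times H\times A)/\{(g,h,\phi(g,h)^{-1}):(g,h)\in D\}$. For an $A$-fibered $(G,H)$-biset $U$ and $(H,K)$-biset $V$, $U\otimes_{AH}V$ is the set of those $(H\times A)$-orbits $u\otimes v$ of $U\times V$ under $(h,a)(u,v)=(u(ha)^{-1},hav)$ on which the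 induced $A$-action is free. $\mathcal C^A$ is the category with objects finite groups, $\mathrm{Hom}_{\mathcal C^A}(H,G)=B^A_R(G,H)$, composition induced by $\otimes_{AH}$, identities $\left[\frac{G\times G}{\Delta(G),1}\right]$. Data. $\mathcal G$ is a class of finite groups, $\Sigma_{\mathcal G}(G)=\{H\le G: H\in\mathcal G\}$, and $\mathcal S$ is a family of subsets $\mathcal S(G,H)\subseteq\mathcal M(G\times H)$, $G,H\in\mathcal G$. Axioms: (i) $(\Delta(G),1)\in\mathcal S(G,G)$ for $G\in\mathcal G$. (ii) $\mathcal S(G,H)$ is closed under $(G\times H)$-conjugation. (iii) For $(V,\phi)\in\mathcal S(G,H)$, $(U,\psi)\in\mathcal S(H,K)$ with $\phi_2=\psi_1$ on $k_2(V)\cap k_1(U)$: $(V*U,\phi*\psi)\in\mathcal S(G,K)$. (vii) For $(D,\phi)\in\mathcal S(G,H)$: $p_2(D)\in\mathcal G$, and for all $K\in\Sigma_{\mathcal G}(p_2(D))$, $D*K\in\mathcal G$ and $(D,\phi)*(\Delta(K),1)\in\mathcal S(D*K,K)$. (viii) For $(D,\phi)\in\mathcal S(G,H)$: $p_1(D)\in\mathcal G$, and for all $K\in\Sigma_{\mathcal G}(p_1(D))$, $K*D\in\mathcal G$ and $(\Delta(K),1)*(D,\phi)\in\mathcal S(K,K*D)$. $\mathcal C^A(\mathcal G,\mathcal S)$ denotes the subcategory of $\mathcal C^A$ with object class $\mathcal G$ in which the morphisms from $H$ to $G$ are the $R$-span of the $\left[\frac{G\times H}{D,\phi}\right]$ with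 $(D,\phi)\in\mathcal S(G,H)$; $\mathcal C^A(\mathcal G,\mathcal S^+)$ is defined in the same way from $\mathcal S^+(G,H)=\{(D,\phi)\in\mathcal M(G\times H): p_1(D),p_2(D)\in\mathcal G,\ (D,\phi)\in\mathcal S(p_1(D),p_2(D))\}$. $\mathcal F^A_{\mathcal D,R}$ is the category of $R$-linear functors $\mathcal D\to R\text{-Mod}$, and similarly for $\mathcal D^+$. The construction $F^+$. Let $F\in\mathcal F^A_{\mathcal D,R}$. For $G\in\mathcal G$, $\mathcal M'(G)=\{(K,\lambda):K\in\Sigma_{\mathcal G}(G),\lambda\in K^*\}$, and $F^+(G)\le\bigoplus_{(K,\lambda)\in\mathcal M'(G)}F(K)$ is the submodule of families $(x_{(K,\lambda)})$ with ${}^gx_{(K,\lambda)}=x_{({}^gK,{}^g\lambda)}$ for all $g\in G$, where ${}^g:F(K)\to F({}^gK)$ is $F$ applied to $\left[\frac{{}^gK\times K}{\{(gkg^{-1},k):k\in K\},1}\right]$. For an $A$-fibered $(G,H)$-biset $U$, $u\in U$, $K\le G$ let $K^u=K*(G\times H)_u$ and $(K\times H)_u=\{(k,h)\in(G\times H)_u:k\in K\}$. If all stabilizing pairs of $U$ are in $\mathcal S^+(G,H)$, then $F^+([U]):F^+(H)\to F^+(G)$ sends $(x_{(L,\lambda)})$ to $(y_{(K,\alpha)})$ with $$y_{(K,\alpha)}=\sum_{(u,\lambda)}F\left(\left[\frac{K\times K^u}{(K\times H)_u,\phi_u}\right]\right)(x_{(K^u,\lambda)}),$$ the sum over $u$ in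 a set $[A\backslash U/H]$ of representatives of the $(A,H)$-orbits of $U$ with $K\le p_1((G\times H)_u)$ and $\lambda\in(K^u)^*$ such that $\phi_{u,2}=\lambda$ on $k_2((G\times H)_u)\cap K^u$ (where $\phi_{u,2}=(\phi_u)_2$) and $\phi_u|_{(K\times H)_u}*\lambda=\alpha$. This is extended $R$-linearly. A morphism $\varphi:F\to F'$ is sent to the family of maps acting componentwise by $\varphi_K:F(K)\to F'(K)$.
   Formalization: The axioms do not force D^+ to be closed under composition (e.g. groups isomorphic to V4 or Z/2, S = graphs of isomorphisms), so F^+ is asked to respect composition of morphisms of D^+ whenever the composite lies in D^+; if D^+ is a category this is the usual notion of functor. *)

(* Defs.v *)
From HB Require Import structures.
From mathcomp Require Import all_boot.

(* Declared before fingroup is loaded, which reuses the name Group. *)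
HB.mixin Record Group_isAbelian G of Group G := {
  abmulgC : commutative (@mul G)
}.

#[short(type="abGroupType")]
HB.structure Definition AbGroup := {G of Group G & Group_isAbelian G}.

From mathcomp Require Import generic_quotient all_fingroup all_algebra.
From mathcomp Require Import boolp classical_sets functions cardinality fsbigop.

Set Implicit Arguments.
Unset Strict Implicit.
Unset Printing Implicit Defensive.

Import GRing.Theory.

Local Open Scope classical_set_scope.
Local Open Scope quotient_scope.
Local Open Scope group_scope.

Section Pairs.
Variable A : abGroupType.
Implicit Types gT hT kT : finGroupType.

(* A homomorphism K -> A is represented by its extension by 1 outside K, so
   that two pairs (K, kappa) are equal iff they have the same components. *)
Definition is_char gT (K : {set gT}) (f : gT -> A) : bool :=
  [forall x in K, forall y in K, f (x * y) == f x * f y]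
    && [forall (x | x \notin K), f x == 1].

Record mpair gT := MPair {
  mpval : {group gT} * {ffun gT -> A};
  _ : is_char mpval.1 mpval.2 }.

HB.instance Definition _ gT := [isSub for @mpval gT].
HB.instance Definition _ gT := [Choice of mpair gT by <:].

Definition mdom gT (p : mpair gT) : {group gT} := (mpval p).1.
Definition mchi gT (p : mpair gT) : gT -> A := (mpval p).2.

Lemma trivial_char gT (K : {group gT}) : is_char K [ffun=> 1 : A].
Proof.
apply/andP; split.
  apply/forall_inP => x _; apply/forall_inP => y _.
  by rewrite !ffunE mulg1.
by apply/forall_inP => x _; rewrite ffunE.
Qed.

Definition mtriv gT (K : {group gT}) : mpair gT :=
  @MPair gT (K, [ffun=> 1]) (trivial_char K).

Lemma mtriv_chi gT (K : {group gT}) x : mchi (mtriv K) x = 1.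
Proof. by rewrite /mchi ffunE. Qed.

(* The pair (K, f|_K). The trivial character is the default value when f|_K is
   not a homomorphism. *)
Definition mkpair gT (K : {group gT}) (f : gT -> A) : mpair gT :=
  insubd (mtriv K) (K, [ffun x => if x \in K then f x else 1]).

Lemma mkpair_dom gT (K : {group gT}) (f : gT -> A) : mdom (mkpair K f) = K.
Proof. by rewrite /mdom /mkpair val_insubd; case: ifP. Qed.

Lemma mkpair_chi gT (K : {group gT}) (f : gT -> A) x :
  {in K &, {morph f : x y / x * y}} -> x \in K -> mchi (mkpair K f) x = f x.
Proof.
move=> fM Kx; rewrite /mchi /mkpair val_insubd ifT /= ?ffunE ?Kx //.
apply/andP; split; apply/forall_inP => y Ky.
  by apply/forall_inP => z Kz; rewrite !ffunE groupM // Ky Kz fM.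
by rewrite ffunE (negbTE Ky).
Qed.

Lemma mchiM gT (p : mpair gT) : {in mdom p &, {morph mchi p : x y / x * y}}.
Proof.
move=> x y px py; apply/eqP; have /andP[pM _] := valP p.
by move/forall_inP: pM => /(_ x px) /forall_inP; apply.
Qed.

Lemma mchi_out gT (p : mpair gT) x : x \notin mdom p -> mchi p x = 1.
Proof.
move=> px; apply/eqP; have /andP[_ p1] := valP p.
by move/forall_inP: p1 => /(_ x px).
Qed.

Lemma mchi1 gT (p : mpair gT) : mchi p 1 = 1.
Proof. by apply: (mulgI (mchi p 1)); rewrite -mchiM ?group1 // !mulg1. Qed.

Lemma mpair_eqP gT (p q : mpair gT) : mdom p = mdom q ->
  {in mdom p, mchi p =1 mchi q} -> p = q.
Proof.
move=> ed ec; apply: val_inj => /=.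
case: p q ed ec => [[K f] pf] [[L g] pg]; rewrite /mdom /=.
move=> eKL; case: L / eKL pg => pg ec; congr pair; apply/ffunP => x.
have [Kx|nKx] := boolP (x \in K); first exact: ec.
by have := @mchi_out _ (MPair pf) x nKx; have := @mchi_out _ (MPair pg) x nKx;
  rewrite /mchi /= => -> ->.
Qed.

Definition mconj gT (g : gT) (p : mpair gT) : mpair gT :=
  mkpair (mdom p :^ g^-1)%G (fun x => mchi p (x ^ g)).

Definition dproj1 gT hT (D : {group gT * hT}) : {group gT} :=
  (@fst gT hT @* D)%G.
Definition dproj2 gT hT (D : {group gT * hT}) : {group hT} :=
  (@snd gT hT @* D)%G.

Definition ker1 gT hT (D : {set gT * hT}) : {set gT} :=
  [set g | (g, 1) \in D]%SET.
Definition ker2 gT hT (D : {set gT * hT}) : {set hT} :=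
  [set h | (1, h) \in D]%SET.

Definition chi1 gT hT (p : mpair (gT * hT)%type) (g : gT) : A := mchi p (g, 1).
Definition chi2 gT hT (p : mpair (gT * hT)%type) (h : hT) : A :=
  (mchi p (1, h))^-1.

Definition diag gT (K : {set gT}) : {set gT * gT} := [set (k, k) | k in K]%SET.

Lemma diagP gT (K : {set gT}) x :
  reflect (x.1 \in K /\ x.2 = x.1) (x \in diag K).
Proof.
case: x => a b; apply: (iffP imsetP) => [[k Kk [-> ->]]|[/= Ka ->]] //.
by exists a.
Qed.

Lemma diag_group_set gT (K : {group gT}) : group_set (diag K).
Proof.
apply/group_setP; split; first by apply/diagP; rewrite /= group1.
by move=> x y /diagP[x1 x2] /diagP[y1 y2]; apply/diagP; rewrite /= groupM // x2 y2.
Qed.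
Canonical diag_group gT (K : {group gT}) := Group (diag_group_set K).

Definition star gT hT kT (D : {set gT * hT}) (V : {set hT * kT}) :
    {set gT * kT} :=
  [set x | [exists h, ((x.1, h) \in D) && ((h, x.2) \in V)]]%SET.

Lemma starP gT hT kT (D : {set gT * hT}) (V : {set hT * kT}) x :
  reflect (exists h, (x.1, h) \in D /\ (h, x.2) \in V) (x \in star D V).
Proof.
by rewrite inE; apply: (iffP existsP) => -[h /andP]; exists h.
Qed.

Lemma star_group_set gT hT kT (D : {group gT * hT}) (V : {group hT * kT}) :
  group_set (star D V).
Proof.
apply/group_setP; split.
  by apply/starP; exists 1; split; apply: group1.
move=> x y /starP[h [Dh Vh]] /starP[l [Dl Vl]]; apply/starP; exists (h * l).
by split; [exact: (groupM Dh Dl)|exact: (groupM Vh Vl)].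
Qed.
Canonical star_group gT hT kT (D : {group gT * hT}) (V : {group hT * kT}) :=
  Group (star_group_set D V).

(* D * K for K <= H, and K * D for K <= G, when D <= G x H *)
Definition lstar gT hT (D : {set gT * hT}) (K : {set hT}) : {set gT} :=
  [set g | [exists k in K, (g, k) \in D]]%SET.
Definition rstar gT hT (K : {set gT}) (D : {set gT * hT}) : {set hT} :=
  [set h | [exists k in K, (k, h) \in D]]%SET.

Lemma lstarP gT hT (D : {set gT * hT}) (K : {set hT}) g :
  reflect (exists2 k, k \in K & (g, k) \in D) (g \in lstar D K).
Proof. by rewrite inE; apply: (iffP exists_inP). Qed.

Lemma rstarP gT hT (K : {set gT}) (D : {set gT * hT}) h :
  reflect (exists2 k, k \in K & (k, h) \in D) (h \in rstar K D).
Proof. by rewrite inE; apply: (iffP exists_inP). Qed.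

Lemma lstar_group_set gT hT (D : {group gT * hT}) (K : {group hT}) :
  group_set (lstar D K).
Proof.
apply/group_setP; split; first by apply/lstarP; exists 1; exact: group1.
move=> x y /lstarP[k Kk Dk] /lstarP[l Kl Dl]; apply/lstarP.
by exists (k * l); [exact: groupM|exact: (groupM Dk Dl)].
Qed.
Canonical lstar_group gT hT (D : {group gT * hT}) (K : {group hT}) :=
  Group (lstar_group_set D K).

Lemma rstar_group_set gT hT (K : {group gT}) (D : {group gT * hT}) :
  group_set (rstar K D).
Proof.
apply/group_setP; split; first by apply/rstarP; exists 1; exact: group1.
move=> x y /rstarP[k Kk Dk] /rstarP[l Kl Dl]; apply/rstarP.
by exists (k * l); [exact: groupM|exact: (groupM Dk Dl)].
Qed.
Canonical rstar_group gT hT (K : {group gT}) (D : {group gT * hT}) :=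
  Group (rstar_group_set K D).

Lemma pairM gT hT (a c : gT) (b d : hT) : (a, b) * (c, d) = (a * c, b * d).
Proof. by []. Qed.

Lemma pairV gT hT (a : gT) (b : hT) : (a, b)^-1 = (a^-1, b^-1).
Proof. by []. Qed.

Definition compat gT hT kT (p : mpair (gT * hT)%type)
    (q : mpair (hT * kT)%type) : Prop :=
  {in ker2 (mdom p) :&: ker1 (mdom q), chi2 p =1 chi1 q}.

Definition mstar gT hT kT (p : mpair (gT * hT)%type)
    (q : mpair (hT * kT)%type) : mpair (gT * kT)%type :=
  mkpair (star_group (mdom p) (mdom q)) (fun x =>
    if [pick h | ((x.1, h) \in mdom p) && ((h, x.2) \in mdom q)] is Some h
    then mchi p (x.1, h) * mchi q (h, x.2) else 1).

Definition lcompat gT hT (p : mpair (gT * hT)%type) (l : mpair hT) : Prop :=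
  {in ker2 (mdom p) :&: mdom l, chi2 p =1 mchi l}.

Definition mlstar gT hT (p : mpair (gT * hT)%type) (l : mpair hT) : mpair gT :=
  mkpair (lstar_group (mdom p) (mdom l)) (fun g =>
    if [pick k in mdom l | (g, k) \in mdom p] is Some k
    then mchi p (g, k) * mchi l k else 1).

Lemma mulgACA_ab (a b c d : A) : (a * b) * (c * d) = (a * c) * (b * d).
Proof. by rewrite mulgA -(mulgA a) (abmulgC b) !mulgA. Qed.

Lemma mstarE gT hT kT (p : mpair (gT * hT)%type) (q : mpair (hT * kT)%type)
    g h k : compat p q -> (g, h) \in mdom p -> (h, k) \in mdom q ->
  mchi (mstar p q) (g, k) = mchi p (g, h) * mchi q (h, k).
Proof.
move=> pq.
have eqv g' k' h1 h2 : (g', h1) \in mdom p -> (h1, k') \in mdom q ->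
    (g', h2) \in mdom p -> (h2, k') \in mdom q ->
    mchi p (g', h1) * mchi q (h1, k') = mchi p (g', h2) * mchi q (h2, k').
  move=> p1 q1 p2 q2.
  have p3 : (1, h1^-1 * h2) \in mdom p.
    by have := groupM (groupVr p1) p2; rewrite pairV pairM mulVg.
  have q3 : (h1^-1 * h2, 1) \in mdom q.
    by have := groupM (groupVr q1) q2; rewrite pairV pairM mulVg.
  have ep : (g', h2) = (g', h1) * (1, h1^-1 * h2).
    by rewrite pairM mulg1 mulKVg.
  have eq : (h2, k') = (h1, k') * (h1^-1 * h2, 1).
    by rewrite pairM mulg1 mulKVg.
  rewrite ep eq !mchiM // mulgACA_ab.
  have := pq (h1^-1 * h2); rewrite !inE p3 q3 => /(_ isT).
  by rewrite /chi2 /chi1 => <-; rewrite mulgV mulg1.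
move=> pgh qhk; rewrite mkpair_chi /=.
- case: pickP => [h' /andP[p' q']|/(_ h)]; last by rewrite /= pgh qhk.
  exact: eqv.
- move=> [g1 k1] [g2 k2] /starP[/= h1 [p1 q1]] /starP[/= h2 [p2 q2]].
  have p3 := groupM p1 p2; have q3 := groupM q1 q2.
  case: pickP => [h3 /andP[p3' q3']|/(_ (h1 * h2))]; last first.
    by move=> /negP []; apply/andP; split; [exact: p3|exact: q3].
  case: pickP => [h1' /andP[p1' q1']|/(_ h1)]; last by rewrite /= p1 q1.
  case: pickP => [h2' /andP[p2' q2']|/(_ h2)]; last by rewrite /= p2 q2.
  rewrite (eqv _ _ _ _ p3' q3' p3 q3) (eqv _ _ _ _ p1' q1' p1 q1).
  rewrite (eqv _ _ _ _ p2' q2' p2 q2) mulgACA_ab.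
  by rewrite -!mchiM.
- by apply/starP; exists h.
Qed.

Lemma mlstarE gT hT (p : mpair (gT * hT)%type) (l : mpair hT) g k :
  lcompat p l -> (g, k) \in mdom p -> k \in mdom l ->
  mchi (mlstar p l) g = mchi p (g, k) * mchi l k.
Proof.
move=> pq.
have eqv g' h1 h2 : (g', h1) \in mdom p -> h1 \in mdom l ->
    (g', h2) \in mdom p -> h2 \in mdom l ->
    mchi p (g', h1) * mchi l h1 = mchi p (g', h2) * mchi l h2.
  move=> p1 q1 p2 q2.
  have p3 : (1, h1^-1 * h2) \in mdom p.
    by have := groupM (groupVr p1) p2; rewrite pairV pairM mulVg.
  have q3 : h1^-1 * h2 \in mdom l by rewrite groupM ?groupV.
  have ep : (g', h2) = (g', h1) * (1, h1^-1 * h2).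
    by rewrite pairM mulg1 mulKVg.
  have eq : mchi l h2 = mchi l h1 * mchi l (h1^-1 * h2).
    by rewrite -mchiM // mulKVg.
  rewrite ep mchiM // eq mulgACA_ab.
  have := pq (h1^-1 * h2); rewrite !inE p3 q3 => /(_ isT).
  by rewrite /chi2 => <-; rewrite mulgV mulg1.
move=> pgk lk; rewrite mkpair_chi /=.
- case: pickP => [h' /andP[p' q']|/(_ k)]; last by rewrite /= pgk lk.
  exact: eqv.
- move=> g1 g2 /lstarP[h1 q1 p1] /lstarP[h2 q2 p2].
  have p3 := groupM p1 p2; have q3 := groupM q1 q2.
  case: pickP => [h3 /andP[p3' q3']|/(_ (h1 * h2))]; last first.
    by move=> /negP []; apply/andP; split; [exact: q3|exact: p3].
  case: pickP => [h1' /andP[p1' q1']|/(_ h1)]; last by rewrite /= p1 q1.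
  case: pickP => [h2' /andP[p2' q2']|/(_ h2)]; last by rewrite /= p2 q2.
  rewrite (eqv _ _ _ q3' p3' p3 q3) (eqv _ _ _ q1' p1' p1 q1).
  rewrite (eqv _ _ _ q2' p2' p2 q2) mulgACA_ab.
  by rewrite -!mchiM.
- by apply/lstarP; exists k.
Qed.

(* ({(k, h) \in D : k \in K}, restriction of the character) *)
Definition mrestr gT hT (K : {group gT}) (p : mpair (gT * hT)%type) :
    mpair (gT * hT)%type :=
  mkpair (mdom p :&: setX_group K [group of [set: hT]%SET])%G (mchi p).

End Pairs.

(* R (x)_Z (Grothendieck group of the isomorphism classes in T under sum):
   formal sums of elementary tensors (r, U) modulo the generating relations. *)
Section Grothendieck.
Variables (R : comPzRingType) (T : Type).
Variables (iso : T -> T -> Prop) (sum : T -> T -> T).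
Local Open Scope ring_scope.

Inductive groth_eq : seq (R * {classic T}) -> seq (R * {classic T}) -> Prop :=
| groth_refl s : groth_eq s s
| groth_sym s t : groth_eq s t -> groth_eq t s
| groth_trans s t u : groth_eq s t -> groth_eq t u -> groth_eq s u
| groth_cat s s' t t' :
    groth_eq s s' -> groth_eq t t' -> groth_eq (s ++ t) (s' ++ t')
| groth_catC s t : groth_eq (s ++ t) (t ++ s)
| groth_zero U : groth_eq [:: (0, U)] [::]
| groth_add r r' U : groth_eq [:: (r, U); (r', U)] [:: (r + r', U)]
| groth_iso r U V : iso U V -> groth_eq [:: (r, U)] [:: (r, V)]
| groth_sum r U V : groth_eq [:: (r, sum U V)] [:: (r, U); (r, V)].

Definition groth_rel s t := `[< groth_eq s t >].

Lemma groth_rel_refl : reflexive groth_rel.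
Proof. by move=> s; apply/asboolP; exact: groth_refl. Qed.
Lemma groth_rel_sym : symmetric groth_rel.
Proof. by move=> s t; apply/asboolP/asboolP; exact: groth_sym. Qed.
Lemma groth_rel_trans : transitive groth_rel.
Proof.
by move=> t s u /asboolP st /asboolP tu; apply/asboolP; exact: groth_trans tu.
Qed.

Definition groth_equiv := EquivRel groth_rel
  groth_rel_refl groth_rel_sym groth_rel_trans.

Definition groth : Type := {eq_quot groth_equiv}.
HB.instance Definition _ := EqQuotient.on groth.
HB.instance Definition _ := Choice.on groth.

Definition groth_class (s : seq (R * {classic T})) : groth :=
  \pi_({eq_quot groth_equiv}) s.

Definition groth_rep (x : groth) : seq (R * {classic T}) :=
  generic_quotient.repr x.

Lemma groth_classP s t : groth_class s = groth_class t <-> groth_eq s t.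
Proof.
split; first by move/eqquotP/asboolP.
by move=> st; apply/eqquotP/asboolP.
Qed.

Lemma groth_reprK x : groth_class (groth_rep x) = x.
Proof. exact: reprK. Qed.

Lemma groth_repr s : groth_eq (groth_rep (groth_class s)) s.
Proof. by apply/groth_classP; rewrite groth_reprK. Qed.

Definition groth_gen (U : T) : groth := groth_class [:: (1, U)].

Definition gscale (r : R) (s : seq (R * {classic T})) :=
  [seq (r * c.1, c.2) | c <- s].

Lemma gscale_eq r s t : groth_eq s t -> groth_eq (gscale r s) (gscale r t).
Proof.
elim=> {s t} /=.
- by move=> s; exact: groth_refl.
- by move=> s t _; exact: groth_sym.
- by move=> s t u _ st _; exact: groth_trans.
- by move=> s s' t t' _ + _; rewrite /gscale !map_cat; exact: groth_cat.
- by move=> s t; rewrite /gscale !map_cat; exact: groth_catC.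
- by move=> U; rewrite /gscale /= mulr0; exact: groth_zero.
- by move=> r1 r2 U; rewrite /gscale /= mulrDr; exact: groth_add.
- by move=> r1 U V UV; exact: groth_iso.
- by move=> r1 U V; exact: groth_sum.
Qed.

Definition groth0 : groth := groth_class [::].
Definition grothD (x y : groth) : groth := groth_class (groth_rep x ++ groth_rep y).
Definition grothZ (r : R) (x : groth) : groth := groth_class (gscale r (groth_rep x)).
Definition grothN (x : groth) : groth := grothZ (- 1) x.

Lemma grothD_class s t :
  grothD (groth_class s) (groth_class t) = groth_class (s ++ t).
Proof. by apply/groth_classP; apply: groth_cat; exact: groth_repr. Qed.

Lemma grothZ_class r s : grothZ r (groth_class s) = groth_class (gscale r s).
Proof. by apply/groth_classP; apply: gscale_eq; exact: groth_repr. Qed.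

Lemma groth_ind (P : groth -> Prop) :
  (forall s, P (groth_class s)) -> forall x, P x.
Proof. by move=> Ps x; rewrite -[x]groth_reprK. Qed.

Lemma grothDA : associative grothD.
Proof.
move=> x y z; elim/groth_ind: x => s; elim/groth_ind: y => t.
by elim/groth_ind: z => u; rewrite !grothD_class catA.
Qed.

Lemma grothDC : commutative grothD.
Proof.
move=> x y; elim/groth_ind: x => s; elim/groth_ind: y => t.
by rewrite !grothD_class; apply/groth_classP; exact: groth_catC.
Qed.

Lemma groth0D : left_id groth0 grothD.
Proof. by move=> x; elim/groth_ind: x => s; rewrite grothD_class. Qed.

Lemma gscale_split r r' s :
  groth_eq (gscale (r + r') s) (gscale r s ++ gscale r' s).
Proof.
elim: s => [|[a U] s IHs]; first exact: groth_refl.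
have -> : gscale r ((a, U) :: s) ++ gscale r' ((a, U) :: s) =
    [:: (r * a, U)] ++ ((gscale r s ++ [:: (r' * a, U)]) ++ gscale r' s).
  by rewrite /= -catA.
apply: (@groth_trans _ ([:: (r * a, U); (r' * a, U)] ++ (gscale r s ++ gscale r' s))).
  apply: (@groth_cat [:: ((r + r') * a, U)]) => //.
  by rewrite mulrDl; apply/groth_sym/groth_add.
apply: (@groth_cat [:: (r * a, U)] _ ([:: (r' * a, U)] ++ (gscale r s ++ gscale r' s))).
  exact: groth_refl.
rewrite catA; apply: groth_cat; first exact: groth_catC.
exact: groth_refl.
Qed.

Lemma gscale0 s : groth_eq (gscale 0 s) [::].
Proof.
elim: s => [|[a U] s IHs]; first exact: groth_refl.
apply: (@groth_cat [:: (0 * a, U)] [::] (gscale 0 s) [::]) => //.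
by rewrite mul0r; exact: groth_zero.
Qed.

Lemma gscale1 s : gscale 1 s = s.
Proof. by rewrite /gscale (eq_map (g := id)) ?map_id // => -[a U]; rewrite mul1r. Qed.

Lemma grothND : left_inverse groth0 grothN grothD.
Proof.
move=> x; elim/groth_ind: x => s; rewrite /grothN grothZ_class grothD_class.
apply/groth_classP; rewrite -{2}[s]gscale1.
apply: groth_trans (gscale0 s); apply: groth_sym.
by rewrite -[X in gscale X _](addNr (1 : R)); exact: gscale_split.
Qed.

HB.instance Definition _ :=
  GRing.isZmodule.Build groth grothDA grothDC groth0D grothND.

Lemma grothDE (x y : groth) : x + y = grothD x y.
Proof. by []. Qed.

Lemma grothZA r r' x : grothZ r (grothZ r' x) = grothZ (r * r') x.
Proof.
elim/groth_ind: x => s; rewrite !grothZ_class /gscale -map_comp.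
by congr groth_class; apply: eq_map => c /=; rewrite mulrA.
Qed.

Lemma grothZ1 : left_id 1 grothZ.
Proof. by move=> x; elim/groth_ind: x => s; rewrite grothZ_class gscale1. Qed.

Lemma grothZDr : right_distributive grothZ +%R.
Proof.
move=> r x y; elim/groth_ind: x => s; elim/groth_ind: y => t.
rewrite !grothDE grothD_class !grothZ_class grothD_class.
by rewrite /gscale map_cat.
Qed.

Lemma grothZDl x : {morph grothZ^~ x : r r' / r + r'}.
Proof.
move=> r r'; elim/groth_ind: x => s.
rewrite grothDE !grothZ_class grothD_class.
by apply/groth_classP; exact: gscale_split.
Qed.

HB.instance Definition _ :=
  GRing.Zmodule_isLmodule.Build R groth grothZA grothZ1 grothZDr grothZDl.

Lemma grothZE r (x : groth) : r *: x = grothZ r x.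
Proof. by []. Qed.

(* The R-linear extension of an isomorphism invariant additive map. *)
Definition groth_lift (M : lmodType R) (f : T -> M) (x : groth) : M :=
  \sum_(c <- groth_rep x) c.1 *: f c.2.

Definition groth_invariant (M : lmodType R) (f : T -> M) : Prop :=
  (forall U V, iso U V -> f U = f V) /\ {morph f : U V / sum U V >-> (U + V)%R}.

Section Lift.
Variables (M : lmodType R) (f : T -> M).
Hypothesis fP : groth_invariant f.

Lemma groth_lift_class s :
  groth_lift f (groth_class s) = \sum_(c <- s) c.1 *: f c.2.
Proof.
suff eqf a b : groth_eq a b ->
    \sum_(c <- a) c.1 *: f c.2 = \sum_(c <- b) c.1 *: f c.2.
  exact/eqf/groth_repr.
elim=> {a b s} //.
- by move=> s t u _ -> _ ->.
- by move=> s s' t t' _ e1 _ e2; rewrite !big_cat /= e1 e2.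
- by move=> s t; rewrite !big_cat /= addrC.
- by move=> U; rewrite big_seq1 big_nil scale0r.
- by move=> r r' U; rewrite !big_cons !big_nil /= !addr0 scalerDl.
- by move=> r U V UV; rewrite !big_seq1 /= (fP.1 _ _ UV).
- by move=> r U V; rewrite !big_cons !big_nil /= !addr0 fP.2 scalerDr.
Qed.

Lemma groth_lift_linear : linear (groth_lift f).
Proof.
move=> r x y; elim/groth_ind: x => s; elim/groth_ind: y => t.
rewrite grothDE grothZE grothZ_class grothD_class.
rewrite !groth_lift_class big_cat /= big_map scaler_sumr; congr (_ + _).
by apply: eq_bigr => c _ /=; rewrite scalerA.
Qed.

Lemma groth_lift_gen U : groth_lift f (groth_gen U) = f U.
Proof. by rewrite groth_lift_class big_seq1 scale1r. Qed.

End Lift.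
End Grothendieck.

Section Spans.
Variables (R : comPzRingType) (V : lmodType R).
Local Open Scope ring_scope.

Definition Rspan (X : set V) : set V :=
  [set v | exists2 s : seq (R * V), (forall c, c \in s -> X c.2)
                                  & v = \sum_(c <- s) c.1 *: c.2].
End Spans.

Section FiberedSets.
Variable A : abGroupType.
Implicit Types gT hT kT : finGroupType.

(* fact x a u is the image of u under (x, a); it is only meaningful for x in G. *)
Record fibset gT (G : {group gT}) := FibSet {
  fcar :> Type;
  fact : gT -> A -> fcar -> fcar;
  fact1 : forall u, fact 1 1 u = u;
  factM : forall x y a b u, x \in G -> y \in G ->
    fact (x * y) (a * b) u = fact x a (fact y b u);
  ffree : forall a u, fact 1 a u = u -> a = 1;
  ffin : finite_set (range (fun u => range (fun a => fact 1 a u))) }.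

Definition fiso gT (G : {group gT}) (U V : fibset G) : Prop :=
  exists2 f : U -> V, bijective f &
    forall x a u, x \in G -> f (fact x a u) = fact x a (f u).

Section Stabilizer.
Variables (gT : finGroupType) (G : {group gT}) (U : fibset G) (u : U).

Definition fstab : {set gT} :=
  [set x in G | `[< exists a, fact x 1 u = fact 1 a u >]]%SET.

Lemma fstabP x : reflect (x \in G /\ exists a, fact x 1 u = fact 1 a u)
  (x \in fstab).
Proof.
by rewrite inE; apply: (iffP andP) => -[Gx /asboolP xu]; split => //; apply/asboolP.
Qed.

Lemma factMl x y u' : x \in G -> y \in G ->
  fact (x * y) 1 u' = fact x 1 (fact y 1 u') :> U.
Proof. by move=> Gx Gy; rewrite -factM // mulg1. Qed.

Lemma factMr a b u' : fact 1 (a * b) u' = fact 1 a (fact 1 b u') :> U.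
Proof. by rewrite -factM ?group1 // mulg1. Qed.

Lemma factC x a u' : x \in G -> fact x 1 (fact 1 a u') = fact 1 a (fact x 1 u') :> U.
Proof. by move=> Gx; rewrite -!factM ?group1 // !mul1g !mulg1. Qed.

Lemma factE x a u' : x \in G -> fact x a u' = fact 1 a (fact x 1 u') :> U.
Proof. by move=> Gx; rewrite -!factM ?group1 // !mul1g !mulg1. Qed.

Lemma ffree2 a b u' : fact 1 a u' = fact 1 b u' :> U -> a = b.
Proof.
move=> /(congr1 (fact 1 a^-1)); rewrite -!factMr mulVg fact1 => /esym /ffree.
by move/(congr1 (mulg a)); rewrite mulKVg mulg1.
Qed.

Lemma fstab_group_set : group_set fstab.
Proof.
apply/group_setP; split; first by apply/fstabP; split=> //; exists 1.
move=> x y /fstabP[Gx [a xa]] /fstabP[Gy [b yb]]; apply/fstabP.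
split; first exact: groupM.
by exists (b * a); rewrite factMl // yb factC // xa -factMr.
Qed.
Canonical fstab_group := Group fstab_group_set.

Definition fchi (x : gT) : A := xget 1 [set a | fact x 1 u = fact 1 a u].

Definition stab_pair : mpair A gT := mkpair fstab_group fchi.

Lemma stab_pairE x : x \in fstab ->
  fact x 1 u = fact 1 (mchi stab_pair x) u.
Proof.
have cE y : y \in fstab -> fact y 1 u = fact 1 (fchi y) u.
  by move=> /fstabP[_ [a ya]]; rewrite /fchi; case: xgetP => [b _ //|/(_ a)].
move=> xu; suff -> : mchi stab_pair x = fchi x by exact: cE.
apply: mkpair_chi => // y z yu zu.
move: (yu) (zu) => /fstabP[Gy _] /fstabP[Gz _].
apply: (@ffree2 _ _ u); rewrite -cE ?groupM // factMl // (cE z) // factC //.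
by rewrite (cE y) // -factMr abmulgC.
Qed.

End Stabilizer.

Section Transitive.
Variables (gT : finGroupType) (G : {group gT}) (p : mpair A gT).

(* Elements of gT are coded by their rank in its enumeration: the carrier of a
   transitive fibered set then lives in a smaller universe than finGroupType,
   so that the type of all fibered sets fits in the universe of choiceType. *)
Definition frank (g : gT) : nat := index g (enum gT).
Definition funrank (n : nat) : gT := nth 1 (enum gT) n.

Lemma frankK : cancel frank funrank.
Proof. by move=> g; rewrite /funrank nth_index ?mem_enum. Qed.

(* the coset (g, a) D_phi of D_phi = {(d, phi(d)^-1) : d in D} *)
Definition tcoset (g : gT) (a : A) : set (nat * A) :=
  [set y | exists2 d, d \in mdom p &
     y = (frank (g * d), a * (mchi p d)^-1)].

Definition tcar : Type :=
  {c : nat * A -> Prop |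
    exists2 g, g \in G & exists a, c = tcoset g a}.

Definition tshift (g : gT) (a : A) (c : set (nat * A)) :
    set (nat * A) :=
  [set (frank (g * funrank y.1), a * y.2) | y in c].

Lemma tshift_coset g a h b :
  tshift g a (tcoset h b) = tcoset (g * h) (a * b).
Proof.
apply/seteqP; split=> y /=.
  by move=> [_ [d pd ->] <-]; exists d; rewrite //= frankK !mulgA.
move=> [d pd ->]; exists (frank (h * d), b * (mchi p d)^-1).
  by exists d.
by rewrite /= frankK !mulgA.
Qed.

Lemma tshift_proof g a (c : tcar) : g \in G ->
  exists2 h, h \in G & exists b, tshift g a (sval c) = tcoset h b.
Proof.
move=> Gg; case: c => c /= [h Gh [b ->]].
by exists (g * h); [exact: groupM|exists (a * b); rewrite tshift_coset].
Qed.

Definition tact (g : gT) (a : A) (c : tcar) : tcar :=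
  if pselect (g \in G) is left Gg then exist _ _ (tshift_proof a c Gg) else c.

Lemma tcar_inj (c d : tcar) : sval c = sval d -> c = d.
Proof. by case: c d => c cP [d dP] /= e; case: d / e dP => dP; congr exist. Qed.

Lemma tactE g a c : g \in G -> sval (tact g a c) = tshift g a (sval c).
Proof. by rewrite /tact; case: pselect. Qed.

Lemma tact1 c : tact 1 1 c = c.
Proof.
apply: tcar_inj; rewrite tactE //; case: c => c /= [g _ [a ->]].
by rewrite tshift_coset !mul1g.
Qed.

Lemma tactM x y a b c : x \in G -> y \in G ->
  tact (x * y) (a * b) c = tact x a (tact y b c).
Proof.
move=> Gx Gy; apply: tcar_inj; rewrite !tactE ?groupM //.
by case: c => c /= [g _ [d ->]]; rewrite !tshift_coset !mulgA.
Qed.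

Lemma tact_free a c : tact 1 a c = c -> a = 1.
Proof.
move/(congr1 sval); rewrite tactE //; case: c => c /= [g _ [b ->]].
rewrite tshift_coset mul1g => e.
have: tcoset g (a * b) (frank g, a * b).
  by exists 1; rewrite ?group1 // mchi1 invg1 !mulg1.
rewrite e => -[d pd [/(can_inj frankK)/esym/eqP]]; rewrite -{2}[g]mulg1.
rewrite (inj_eq (mulgI g)) => /eqP ->; rewrite mchi1 invg1 mulg1.
by move/(congr1 (fun z => z * b^-1)); rewrite mulgK mulgV.
Qed.

Lemma tact_fin : finite_set (range (fun c => range (fun a => tact 1 a c))).
Proof.
pose o (g : gT) : set tcar := [set c | exists a, sval c = tcoset g a].
apply: (@sub_finite_set _ _ (o @` setT)); last first.
  by apply: finite_image; exact: finite_finset.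
move=> _ [c _ <-]; have [g Gg [a ca]] := svalP c.
exists g => //; apply/seteqP; split=> d.
  move=> [b db]; exists (b * a^-1) => //; apply: tcar_inj.
  by rewrite tactE // ca tshift_coset mul1g mulgKV db.
by move=> [b _ <-]; exists (b * a); rewrite tactE // ca tshift_coset mul1g.
Qed.

Definition transitive_set : fibset G := FibSet tact1 tactM tact_free tact_fin.

End Transitive.

Section Sum.
Variables (gT : finGroupType) (G : {group gT}) (U V : fibset G).

Definition sum_act x a (w : U + V) : U + V :=
  match w with inl u => inl (fact x a u) | inr v => inr (fact x a v) end.

Lemma sum_act1 w : sum_act 1 1 w = w.
Proof. by case: w => w /=; rewrite fact1. Qed.

Lemma sum_actM x y a b w : x \in G -> y \in G ->
  sum_act (x * y) (a * b) w = sum_act x a (sum_act y b w).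
Proof. by move=> Gx Gy; case: w => w /=; rewrite factM. Qed.

Lemma sum_act_free a w : sum_act 1 a w = w -> a = 1.
Proof. by case: w => w [] /ffree. Qed.

Lemma sum_act_fin :
  finite_set (range (fun w => range (fun a => sum_act 1 a w))).
Proof.
apply: (@sub_finite_set _ _
  ((fun c => inl @` c) @` range (fun u : U => range (fun a => fact 1 a u)) `|`
   (fun c => inr @` c) @` range (fun v : V => range (fun a => fact 1 a v)))).
  move=> _ [[u|v] _ <-]; [left|right].
    by exists (range (fun a => fact 1 a u)); [exists u|rewrite image_comp].
  by exists (range (fun a => fact 1 a v)); [exists v|rewrite image_comp].
by rewrite finite_setU; split; apply: finite_image; exact: ffin.
Qed.

Definition fib_sum : fibset G :=
  FibSet sum_act1 sum_actM sum_act_free sum_act_fin.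

End Sum.

(* A-fibered (G, H)-bisets: g a u h b = ((g, h^-1), a b) u *)
Definition biset gT hT (G : {group gT}) (H : {group hT}) :=
  fibset (setX_group G H).

Section Tensor.
Variables (gT hT kT : finGroupType).
Variables (G : {group gT}) (H : {group hT}) (K : {group kT}).
Variables (U : biset G H) (V : biset H K).

(* the (H x A)-orbit of (u, v), under (h, a)(u, v) = (u (h a)^-1, h a v) *)
Definition torbit (u : U) (v : V) : set (U * V) :=
  [set w | exists2 h, h \in H & exists a,
     w = (fact (1, h) a^-1 u, fact (h, 1) a v)].

Definition torbit_free (u : U) (v : V) : Prop :=
  forall a, torbit (fact 1 a u) v = torbit u v -> a = 1.

Definition tens_car : Type :=
  {c : U * V -> Prop | exists u v, c = torbit u v /\ torbit_free u v}.

Definition tens_shift (x : gT * kT) (a : A) (c : set (U * V)) : set (U * V) :=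
  [set (fact (x.1, 1) a w.1, fact (1, x.2) 1 w.2) | w in c].

Lemma biE1 (g : gT) (h : hT) : (g, h) = (g, 1) * (1, h).
Proof. by rewrite pairM mulg1 mul1g. Qed.

Lemma tens_shift_orbit x a u v : x \in setX_group G K ->
  tens_shift x a (torbit u v) =
  torbit (fact (x.1, 1) a u) (fact (1, x.2) 1 v).
Proof.
rewrite inE => /andP[Gx Kx].
have e1 h b : h \in H -> fact (x.1, 1) a (fact (1, h) b^-1 u) =
    fact (1, h) b^-1 (fact (x.1, 1) a u).
  move=> Hh; rewrite -!factM ?inE /= ?Gx ?Hh ?group1 //.
  by rewrite !pairM !mul1g !mulg1 abmulgC.
have e2 h b : h \in H -> fact (1, x.2) 1 (fact (h, 1) b v) =
    fact (h, 1) b (fact (1, x.2) 1 v).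
  move=> Hh; rewrite -!factM ?inE /= ?Kx ?Hh ?group1 //.
  by rewrite !pairM !mul1g !mulg1.
apply/seteqP; split=> w.
  by move=> [_ [h Hh [b ->]] <-]; exists h => //; exists b; rewrite /= e1 ?e2.
move=> [h Hh [b ->]]; rewrite -e1 // -e2 //.
by exists (fact (1, h) b^-1 u, fact (h, 1) b v) => //; exists h => //; exists b.
Qed.

Lemma torbit_refl u v : torbit u v (u, v).
Proof. by exists 1 => //; exists 1; rewrite invg1 !fact1. Qed.

Lemma torbit_eq u v u' v' : torbit u v (u', v') -> torbit u' v' = torbit u v.
Proof.
move=> [h Hh [a [-> ->]]]; apply/seteqP; split=> w [l Hl [b ->]].
  exists (l * h); first exact: groupM.
  exists (b * a); rewrite -!factM ?inE /= ?Hl ?Hh ?group1 //.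
  by rewrite !pairM !mulg1 invMg abmulgC.
exists (l * h^-1); first by rewrite groupM ?groupV.
exists (b * a^-1); rewrite -!factM ?inE /= ?groupM ?groupV ?Hl ?Hh ?group1 //.
have -> : (b * a^-1)^-1 * a^-1 = b^-1 by rewrite -invMg abmulgC mulgKV.
by rewrite !pairM !mulg1 !mulgKV.
Qed.

Lemma torbit_act (x : gT * kT) a u v : x \in setX_group G K ->
  torbit (fact 1 a (fact (x.1, 1) 1 u)) (fact (1, x.2) 1 v) =
  tens_shift x 1 (torbit (fact 1 a u) v).
Proof.
move=> GKx; rewrite tens_shift_orbit //; move: GKx; rewrite inE => /andP[Gx _].
by rewrite -factC // inE /= Gx group1.
Qed.

Lemma tens_shift_comp x y a b (c : set (U * V)) :
  x \in setX_group G K -> y \in setX_group G K ->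
  tens_shift x a (tens_shift y b c) = tens_shift (x * y) (a * b) c.
Proof.
rewrite !inE => /andP[Gx Kx] /andP[Gy Ky]; rewrite /tens_shift image_comp.
apply: eq_imagel => w _ /=.
by rewrite -!factM ?inE /= ?Gx ?Gy ?Kx ?Ky ?group1 // !pairM !mulg1.
Qed.

Lemma tens_shift1 c :
  (exists u v, c = torbit u v /\ torbit_free u v) -> tens_shift 1 1 c = c.
Proof.
by move=> [u [v [-> _]]]; rewrite tens_shift_orbit ?group1 //= !fact1.
Qed.

Lemma tens_shift_proof x a (c : tens_car) : x \in setX_group G K ->
  exists u v, tens_shift x a (sval c) = torbit u v /\ torbit_free u v.
Proof.
move=> GKx; case: c => c /= [u [v [-> uv]]].
exists (fact (x.1, 1) a u), (fact (1, x.2) 1 v).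
split; first exact: tens_shift_orbit.
move=> b; have GKV : x^-1 \in setX_group G K by rewrite groupV.
rewrite -[torbit (fact (x.1, 1) a u) _](tens_shift_orbit a u v GKx).
have -> : fact 1 b (fact (x.1, 1) a u) =
          fact (x.1, 1) a (fact 1 b u).
  move: GKx; rewrite inE => /andP[Gx _].
  by rewrite -!factM ?inE /= ?Gx ?group1 // mul1g mulg1 abmulgC.
rewrite -(tens_shift_orbit a (fact 1 b u) v GKx).
move=> /(congr1 (tens_shift x^-1 a^-1)).
rewrite !tens_shift_comp // !mulVg !tens_shift_orbit ?group1 //= !fact1.
exact: uv.
Qed.

Definition tens_act x a (c : tens_car) : tens_car :=
  if pselect (x \in setX_group G K) is left GKx
  then exist _ _ (tens_shift_proof a c GKx) else c.

Lemma tens_car_inj (c d : tens_car) : sval c = sval d -> c = d.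
Proof. by case: c d => c cP [d dP] /= e; case: d / e dP => dP; congr exist. Qed.

Lemma tens_actE x a c : x \in setX_group G K ->
  sval (tens_act x a c) = tens_shift x a (sval c).
Proof. by rewrite /tens_act; case: pselect. Qed.

Lemma tens_act1 c : tens_act 1 1 c = c.
Proof.
apply: tens_car_inj; rewrite tens_actE ?group1 //.
by case: c => c /=; exact: tens_shift1.
Qed.

Lemma tens_actM x y a b c : x \in setX_group G K -> y \in setX_group G K ->
  tens_act (x * y) (a * b) c = tens_act x a (tens_act y b c).
Proof.
move=> Gx Gy; apply: tens_car_inj.
by rewrite !tens_actE ?groupM // tens_shift_comp.
Qed.

Lemma tens_act_free a c : tens_act 1 a c = c -> a = 1.
Proof.
move/(congr1 sval); rewrite tens_actE ?group1 //.
case: c => c /= [u [v [-> uv]]].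
by rewrite tens_shift_orbit ?group1 //= fact1; exact: uv.
Qed.

Lemma tens_act_fin :
  finite_set (range (fun c => range (fun a => tens_act 1 a c))).
Proof.
pose o (cd : set U * set V) : set tens_car :=
  [set c | exists u v, [/\ cd.1 u, cd.2 v & sval c = torbit u v]].
apply: (@sub_finite_set _ _ (o @`
   (range (fun u : U => range (fun a => fact 1 a u)) `*`
    range (fun v : V => range (fun a => fact 1 a v))))); last first.
  by apply: finite_image; exact: (finite_setX (ffin U) (ffin V)).
move=> _ [c _ <-]; have [u [v [cuv uv]]] := svalP c.
exists (range (fun a => fact 1 a u), range (fun a => fact 1 a v)).
  by split; [exists u|exists v].
apply/seteqP; split=> d.
  move=> [_ [_ [[a _ <-] [b _ <-] duv]]]; exists (a * b) => //.
  apply: tens_car_inj; rewrite tens_actE ?group1 // cuv duv.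
  rewrite tens_shift_orbit ?group1 //= fact1.
  apply/esym/torbit_eq; exists 1; rewrite ?group1 //; exists b.
  by rewrite -!factM ?group1 // mulg1 abmulgC mulgK.
move=> [a _ <-]; exists (fact 1 a u), v; split.
- by exists a.
- by exists 1 => //; rewrite fact1.
- by rewrite tens_actE ?group1 // cuv tens_shift_orbit ?group1 //= fact1.
Qed.

Definition tensor : biset G K :=
  FibSet tens_act1 tens_actM tens_act_free tens_act_fin.

End Tensor.
End FiberedSets.

Section Composition.
Variable A : abGroupType.

Lemma inj_surj_bij (S T : Type) (f : S -> T) :
  injective f -> (forall y, exists x, f x = y) -> bijective f.
Proof.
move=> fI fS; pose g y := sval (cid (fS y)).
have gK : cancel g f by move=> y; exact: (svalP (cid (fS y))).
by exists g => // x; apply: fI; rewrite gK.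
Qed.

Definition equivariant (gT : finGroupType) (G : {group gT}) (U V : fibset A G)
    (f : U -> V) : Prop :=
  forall x a u, x \in G -> f (fact x a u) = fact x a (f u).

Section TensorMap.
Variables (gT hT kT : finGroupType).
Variables (G : {group gT}) (H : {group hT}) (K : {group kT}).
Variables (U U' : biset A G H) (V V' : biset A H K).
Variables (f : U -> U') (g : V -> V').
Hypotheses (fE : equivariant f) (gE : equivariant g).
Hypotheses (fI : injective f) (gI : injective g).

Let fg (w : U * V) := (f w.1, g w.2).

Let fgI : injective fg.
Proof. by move=> [u v] [u' v'] [/fI -> /gI ->]. Qed.

Lemma torbit_map u v : fg @` torbit u v = torbit (f u) (g v).
Proof.
apply/seteqP; split=> w.
  move=> [_ [h Hh [a ->]] <-]; exists h => //; exists a.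
  by rewrite /fg /= fE ?gE // inE /= Hh group1.
move=> [h Hh [a ->]]; rewrite -fE ?inE /= ?Hh ?group1 // -gE ?inE /= ?Hh ?group1 //.
by exists (fact (1, h) a^-1 u, fact (h, 1) a v) => //; exists h => //; exists a.
Qed.

Lemma fg_image_inj (c d : set (U * V)) : fg @` c = fg @` d -> c = d.
Proof.
move=> cd; apply/seteqP; split=> w wc.
  by have [w' dw /fgI <-] : (fg @` d) (fg w) by rewrite -cd; exists w.
by have [w' dw /fgI <-] : (fg @` c) (fg w) by rewrite cd; exists w.
Qed.

Lemma torbit_free_map u v : torbit_free (f u) (g v) <-> torbit_free u v.
Proof.
split=> uv a.
  move=> /(congr1 (image^~ fg)); rewrite !torbit_map fE //; exact: uv.
by rewrite -fE // -!torbit_map => /fg_image_inj; exact: uv.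
Qed.

Lemma tens_map_proof (c : tens_car U V) :
  exists u v, fg @` sval c = torbit u v /\ torbit_free u v.
Proof.
case: c => c /= [u [v [-> uv]]]; exists (f u), (g v).
by split; [exact: torbit_map|exact/torbit_free_map].
Qed.

Definition tens_map (c : tensor U V) : tensor U' V' :=
  exist _ _ (tens_map_proof c).

Lemma tens_map_equivariant : equivariant tens_map.
Proof.
move=> x a c Gx; apply: tens_car_inj; rewrite /= !tens_actE //=.
case: c => c /= [u [v [-> uv]]].
rewrite tens_shift_orbit // !torbit_map tens_shift_orbit //.
by move: Gx; rewrite inE => /andP[Gx Kx]; rewrite fE ?gE // inE /= ?Gx ?Kx group1.
Qed.

Lemma tens_map_inj : injective tens_map.
Proof.
move=> c d /(congr1 sval) /= /fg_image_inj cd; exact: tens_car_inj.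
Qed.

Lemma tens_map_surj u v (c : tensor U' V') : sval c = torbit (f u) (g v) ->
  exists d, tens_map d = c.
Proof.
move=> cuv; have uv : torbit_free u v.
  case: c cuv => c /= [u' [v' [-> uv']]] e; apply/torbit_free_map => a.
  have : torbit u' v' (f u, g v) by rewrite e; exact: torbit_refl.
  move=> [h Hh [b [-> ->]]].
  have {}Hh : (1, h) \in setX_group G H by rewrite inE /= Hh group1.
  have -> : fact 1 a (fact (1, h) b^-1 u') = fact (1, h) b^-1 (fact 1 a u').
    by rewrite -!factM ?group1 // mul1g mulg1 abmulgC.
  have torE w : torbit (fact (1, h) b^-1 w) (fact (h, 1) b v') = torbit w v'.
    apply: torbit_eq; exists h; last by exists b.
    by move: Hh; rewrite inE /= group1.
  by rewrite !torE; exact: uv'.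
exists (exist _ _ (ex_intro _ u (ex_intro _ v (conj erefl uv)))).
by apply: tens_car_inj; rewrite /= torbit_map.
Qed.

End TensorMap.

Section TensorInvariance.
Variables (gT hT kT : finGroupType).
Variables (G : {group gT}) (H : {group hT}) (K : {group kT}).

Lemma tensor_iso (U U' : biset A G H) (V V' : biset A H K) :
  fiso U U' -> fiso V V' -> fiso (tensor U V) (tensor U' V').
Proof.
move=> [f fB fE] [g gB gE]; have [fI gI] := (bij_inj fB, bij_inj gB).
exists (tens_map fE gE fI gI); last exact: tens_map_equivariant.
apply: inj_surj_bij; first exact: tens_map_inj.
move=> c; have [u' [v' [cuv _]]] := svalP c.
have [[f' _ f'K] [g' _ g'K]] := (fB, gB).
by apply: (@tens_map_surj _ _ _ _ _ _ _ _ _ _ _ _ _ _ _ _ (f' u') (g' v')); rewrite f'K g'K.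
Qed.

Lemma tensor_suml (U U' : biset A G H) (V : biset A H K) :
  fiso (fib_sum (tensor U V) (tensor U' V)) (tensor (fib_sum U U') V).
Proof.
have lE : equivariant (inl : U -> fib_sum U U') by [].
have rE : equivariant (inr : U' -> fib_sum U U') by [].
have lI : injective (inl : U -> fib_sum U U') by move=> ? ? [].
have rI : injective (inr : U' -> fib_sum U U') by move=> ? ? [].
have iE : equivariant (id : V -> V) by [].
have iI : injective (id : V -> V) by [].
pose ml := tens_map lE iE lI iI; pose mr := tens_map rE iE rI iI.
exists (fun w => match w with inl c => ml c | inr c => mr c end); last first.
  by move=> x a [c|c] Gx /=; apply: tens_map_equivariant.
apply: inj_surj_bij => [[c|c] [d|d]|].
- by move/tens_map_inj ->.
- move/(congr1 sval) => /=; have [u [v [-> _]]] := svalP c => /seteqP[+ _].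
  move/(_ (inl u, v)) => -[|[u' v'] _ []] //.
  by exists (u, v) => //; exact: torbit_refl.
- move/(congr1 sval) => /=; have [u [v [-> _]]] := svalP c => /seteqP[+ _].
  move/(_ (inr u, v)) => -[|[u' v'] _ []] //.
  by exists (u, v) => //; exact: torbit_refl.
- by move/tens_map_inj ->.
move=> c; have [[u|u] [v [cuv _]]] := svalP c.
  have [d dc] := @tens_map_surj _ _ _ _ _ _ _ _ _ _ _ _ lE iE lI iI u v c cuv.
  by exists (inl d).
have [d dc] := @tens_map_surj _ _ _ _ _ _ _ _ _ _ _ _ rE iE rI iI u v c cuv.
by exists (inr d).
Qed.

Lemma tensor_sumr (U : biset A G H) (V V' : biset A H K) :
  fiso (fib_sum (tensor U V) (tensor U V')) (tensor U (fib_sum V V')).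
Proof.
have lE : equivariant (inl : V -> fib_sum V V') by [].
have rE : equivariant (inr : V' -> fib_sum V V') by [].
have lI : injective (inl : V -> fib_sum V V') by move=> ? ? [].
have rI : injective (inr : V' -> fib_sum V V') by move=> ? ? [].
have iE : equivariant (id : U -> U) by [].
have iI : injective (id : U -> U) by [].
pose ml := tens_map iE lE iI lI; pose mr := tens_map iE rE iI rI.
exists (fun w => match w with inl c => ml c | inr c => mr c end); last first.
  by move=> x a [c|c] Gx /=; apply: tens_map_equivariant.
apply: inj_surj_bij => [[c|c] [d|d]|].
- by move/tens_map_inj ->.
- move/(congr1 sval) => /=; have [u [v [-> _]]] := svalP c => /seteqP[+ _].
  move/(_ (u, inl v)) => -[|[u' v'] _ []] //.
  by exists (u, v) => //; exact: torbit_refl.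
- move/(congr1 sval) => /=; have [u [v [-> _]]] := svalP c => /seteqP[+ _].
  move/(_ (u, inr v)) => -[|[u' v'] _ []] //.
  by exists (u, v) => //; exact: torbit_refl.
- by move/tens_map_inj ->.
move=> c; have [u [[v|v] [cuv _]]] := svalP c.
  have [d dc] := @tens_map_surj _ _ _ _ _ _ _ _ _ _ _ _ iE lE iI lI u v c cuv.
  by exists (inl d).
have [d dc] := @tens_map_surj _ _ _ _ _ _ _ _ _ _ _ _ iE rE iI rI u v c cuv.
by exists (inr d).
Qed.

End TensorInvariance.

Lemma fiso_refl (gT : finGroupType) (G : {group gT}) (U : fibset A G) : fiso U U.
Proof. by exists id => //; exists id. Qed.

Variable R : comPzRingType.
Local Open Scope ring_scope.

(* B^A_R(G, H), the morphisms H -> G of C^A *)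
Definition BAR (gT hT : finGroupType) (G : {group gT}) (H : {group hT}) :=
  groth R (@fiso A _ (setX_group G H)) (@fib_sum A _ (setX_group G H)).

Definition bclass (gT hT : finGroupType) (G : {group gT}) (H : {group hT})
  (U : biset A G H) : BAR G H := groth_gen R _ _ U.

(* [(G x H) / (D, phi)] *)
Definition trclass (gT hT : finGroupType) (G : {group gT}) (H : {group hT})
    (p : mpair A (gT * hT)%type) : BAR G H :=
  bclass (transitive_set (setX_group G H) p).

Definition bid (gT : finGroupType) (G : {group gT}) : BAR G G :=
  trclass G G (mtriv A (diag_group G)).

Section Comp.
Variables (gT hT kT : finGroupType).
Variables (G : {group gT}) (H : {group hT}) (K : {group kT}).

Definition bcomp (f : BAR G H) (g : BAR H K) : BAR G K :=
  groth_lift (fun U => groth_lift (fun V => bclass (tensor U V)) g) f.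

Lemma bclass_iso (U V : biset A G K) : fiso U V -> bclass U = bclass V.
Proof. by move=> UV; apply/groth_classP; exact: groth_iso. Qed.

Lemma bclass_sum (U V : biset A G K) :
  bclass (fib_sum U V) = bclass U + bclass V.
Proof.
by rewrite grothDE grothD_class; apply/groth_classP; exact: groth_sum.
Qed.

Lemma tensor_invr (U : biset A G H) :
  groth_invariant (@fiso A _ (setX_group H K)) (@fib_sum A _ (setX_group H K))
    (fun V => bclass (tensor U V)).
Proof.
split=> [V V' VV'|V V'].
  by apply: bclass_iso; apply: tensor_iso => //; exact: fiso_refl.
by rewrite -bclass_sum; apply/esym/bclass_iso; exact: tensor_sumr.
Qed.

Lemma tensor_invl (g : BAR H K) :
  groth_invariant (@fiso A _ (setX_group G H)) (@fib_sum A _ (setX_group G H))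
    (fun U : biset A G H => groth_lift (fun V => bclass (tensor U V)) g).
Proof.
elim/groth_ind: g => s; split=> [U U' UU'|U U'].
  rewrite !groth_lift_class; try exact: tensor_invr.
  apply: eq_bigr => c _; congr (_ *: _); apply: bclass_iso.
  by apply: tensor_iso => //; exact: fiso_refl.
rewrite !groth_lift_class; try exact: tensor_invr.
rewrite -big_split; apply: eq_bigr => c _ /=; rewrite -scalerDr; congr (_ *: _).
by rewrite -bclass_sum; apply/esym/bclass_iso; exact: tensor_suml.
Qed.

Lemma bcomp_class (U : biset A G H) (V : biset A H K) :
  bcomp (bclass U) (bclass V) = bclass (tensor U V).
Proof.
by rewrite /bcomp (groth_lift_gen (tensor_invl _)) (groth_lift_gen (tensor_invr _)).
Qed.

Lemma bcomp_linearl (g : BAR H K) : linear (bcomp^~ g).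
Proof. exact: (groth_lift_linear (tensor_invl g)). Qed.

Lemma bcomp_linearr (f : BAR G H) : linear (bcomp f).
Proof.
move=> r g g'; rewrite /bcomp /groth_lift scaler_sumr -big_split.
apply: eq_bigr => c _ /=.
rewrite [X in _ *: X](groth_lift_linear (tensor_invr c.2)).
by rewrite scalerDr !scalerA mulrC.
Qed.

End Comp.
End Composition.

Definition group_class : Type := forall gT : finGroupType, {group gT} -> Prop.

Definition pair_family (A : abGroupType) : Type :=
  forall gT hT : finGroupType, {group gT} -> {group hT} ->
    set (mpair A (gT * hT)%type).

Section FamilyConditions.
Variables (A : abGroupType) (C : group_class) (S : pair_family A).

Definition family_wf : Prop :=
  forall (gT hT : finGroupType) (G : {group gT}) (H : {group hT}) p,
    C G -> C H -> S G H p -> mdom p \subset setX_group G H.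

Definition axiom_i : Prop :=
  forall (gT : finGroupType) (G : {group gT}),
    C G -> S G G (mtriv A (diag_group G)).

Definition axiom_ii : Prop :=
  forall (gT hT : finGroupType) (G : {group gT}) (H : {group hT}) x p,
    C G -> C H -> x \in setX_group G H -> S G H p -> S G H (mconj x p).

Definition axiom_iii : Prop :=
  forall (gT hT kT : finGroupType)
      (G : {group gT}) (H : {group hT}) (K : {group kT}) p q,
    C G -> C H -> C K -> S G H p -> S H K q -> compat p q ->
    S G K (mstar p q).

Definition axiom_vii : Prop :=
  forall (gT hT : finGroupType) (G : {group gT}) (H : {group hT}) p,
    C G -> C H -> S G H p ->
    C (dproj2 (mdom p)) /\
    forall K : {group hT}, K \subset dproj2 (mdom p) -> C K ->
      C (lstar_group (mdom p) K) /\
      S (lstar_group (mdom p) K) K (mstar p (mtriv A (diag_group K))).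

Definition axiom_viii : Prop :=
  forall (gT hT : finGroupType) (G : {group gT}) (H : {group hT}) p,
    C G -> C H -> S G H p ->
    C (dproj1 (mdom p)) /\
    forall K : {group gT}, K \subset dproj1 (mdom p) -> C K ->
      C (rstar_group K (mdom p)) /\
      S K (rstar_group K (mdom p)) (mstar (mtriv A (diag_group K)) p).

Definition splus : pair_family A := fun gT hT G H =>
  [set p | [/\ mdom p \subset setX_group G H, C (dproj1 (mdom p)),
               C (dproj2 (mdom p)) & S (dproj1 (mdom p)) (dproj2 (mdom p)) p]].

End FamilyConditions.

Lemma linear_ext (R : comPzRingType) (M N : lmodType R) (f g : {linear M -> N}) :
  f =1 g -> f = g.
Proof.
case: f g => f [[fD] [fZ]] [g [[gD] [gZ]]] /= /funext fg.
case: g / fg gD gZ => gD gZ.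
by rewrite (Prop_irrelevance fD gD) (Prop_irrelevance fZ gZ).
Qed.

Section Functors.
Variables (A : abGroupType) (R : comPzRingType) (C : group_class).
Local Open Scope ring_scope.

Record gobj := GObj {
  gtype : finGroupType;
  ggrp :> {group gtype};
  gobjP : C ggrp }.

(* For each pair of objects, a set of morphisms H -> G of C^A. *)
Definition homfam : Type := forall G H : gobj, set (BAR A R G H).

(* the morphisms of C^A(C, S): the R-span of the [(G x H) / (D, phi)] *)
Definition homs (S : pair_family A) : homfam := fun G H =>
  Rspan [set trclass R G H p | p in S _ _ G H].

Definition fhom (D : homfam) (G H : gobj) : Type := {f : BAR A R G H | D G H f}.

(* R-linear functors D -> R-Mod with object map ob. When D is a subcategory of
   C^A, the composition law is the usual one. It is phrased so as to make sense
   also when some composites of morphisms of D are not in D: this can happen for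
   D = homs (splus C S) if C is not closed under intersections of subgroups. *)
Record functor_on (D : homfam) (ob : gobj -> lmodType R) := FunctorOn {
  fmor : forall G H : gobj, fhom D G H -> {linear ob H -> ob G};
  fmor_linear : forall (G H : gobj) (r : R) (f g h : fhom D G H),
    sval h = r *: sval f + sval g ->
    forall x, fmor h x = r *: fmor f x + fmor g x;
  fmor_id : forall (G : gobj) (f : fhom D G G),
    sval f = bid A R G -> forall x, fmor f x = x;
  fmor_comp : forall (G H K : gobj)
      (f : fhom D G H) (g : fhom D H K) (h : fhom D G K),
    sval h = bcomp (sval f) (sval g) -> forall x, fmor h x = fmor f (fmor g x)
}.

Record functor (D : homfam) := Functor {
  fob :> gobj -> lmodType R;
  fstr : functor_on D fob }.

Definition fmap (D : homfam) (F : functor D) (G H : gobj) (f : fhom D G H) :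
  {linear F H -> F G} := fmor (fstr F) f.

(* F extended by 0 to the morphisms of C^A outside D *)
Definition fext (D : homfam) (F : functor D) (G H : gobj)
    (f : BAR A R G H) (x : F H) : F G :=
  if pselect (D G H f) is left Df then fmap F (exist _ f Df) x else 0.

Section NatTrans.
Variable D : homfam.

Record nattrans (F F' : functor D) := NatTrans {
  ntapp :> forall G : gobj, {linear F G -> F' G};
  ntP : forall (G H : gobj) (f : fhom D G H) x,
    ntapp G (fmap F f x) = fmap F' f (ntapp H x) }.

Lemma nattransP (F F' : functor D) (phi psi : nattrans F F') :
  (forall G x, phi G x = psi G x) -> phi = psi.
Proof.
case: phi psi => f fP [g gP] /= fg.
have e : f = g by apply: functional_extensionality_dep => G; exact/linear_ext/fg.
by case: g / e gP {fg} => gP; congr NatTrans.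
Qed.

Definition nat_id (F : functor D) : nattrans F F.
Proof. by exists (fun G => idfun : {linear F G -> F G}). Defined.

Definition nat_comp (F F' F'' : functor D)
  (psi : nattrans F' F'') (phi : nattrans F F') : nattrans F F''.
Proof.
exists (fun G => psi G \o phi G : {linear F G -> F'' G}).
by move=> G H f x /=; rewrite !ntP.
Defined.

(* r phi + psi *)
Definition nat_lin (F F' : functor D) (r : R) (phi psi : nattrans F F') :
  nattrans F F'.
Proof.
exists (fun G => (r \*: phi G) \+ psi G : {linear F G -> F' G}).
by move=> G H f x /=; rewrite !ntP linearD linearZ.
Defined.

End NatTrans.
End Functors.

Arguments homs {A} R {C} S G H _.
Arguments fmap {A R C D} F {G H} f.
Arguments fext {A R C D} F {G H} f x.

Section Plus.
Variables (A : abGroupType) (R : comPzRingType) (C : group_class).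
Variable D : homfam A R C.
Local Open Scope ring_scope.

(* M'(G) *)
Record mprime (G : gobj C) := MPrime {
  mppair :> mpair A (gtype G);
  mpsub : mdom mppair \subset G;
  mpC : C (mdom mppair) }.

Definition mpobj (G : gobj C) (i : mprime G) : gobj C := GObj (mpC i).

Definition conj_graph (gT : finGroupType) (g : gT) (K : {set gT}) :
    {set gT * gT} :=
  [set (k ^ g^-1, k) | k in K]%g%SET.

Lemma conj_graphP (gT : finGroupType) (g : gT) (K : {set gT}) x :
  reflect (x.2 \in K /\ x.1 = x.2 ^ g^-1)%g (x \in conj_graph g K).
Proof.
case: x => a b; apply: (iffP imsetP) => [[k Kk [-> ->]]|[/= Kb ->]] //.
by exists b.
Qed.

Lemma conj_graph_group_set (gT : finGroupType) (g : gT) (K : {group gT}) :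
  group_set (conj_graph g K).
Proof.
apply/group_setP; split; first by apply/conj_graphP; rewrite /= group1 conj1g.
move=> x y /conj_graphP[x2 x1] /conj_graphP[y2 y1]; apply/conj_graphP.
by rewrite /= groupM // x1 y1 conjMg.
Qed.
Canonical conj_graph_group (gT : finGroupType) (g : gT) (K : {group gT}) :=
  Group (conj_graph_group_set g K).

(* the class [(gK x K) / ({(g k g^-1, k) : k in K}, 1)], where L stands for gK *)
Definition conj_class (gT : finGroupType) (g : gT) (L K : {group gT}) :
    BAR A R L K :=
  trclass R L K (mtriv A (conj_graph_group g K)).

Section Object.
Variables (F : functor D) (G : gobj C).

Definition plus_supp (x : forall i : mprime G, F (mpobj i)) : Prop :=
  finite_set [set i | x i <> 0].

Definition plus_equiv (x : forall i : mprime G, F (mpobj i)) : Prop :=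
  forall (g : gtype G) (i j : mprime G), g \in G ->
    mppair j = mconj g (mppair i) ->
    x j = fext F (conj_class g (mdom j) (mdom i) : BAR A R (mpobj j) (mpobj i))
            (x i).

Record plus_mod : Type := PlusMod {
  plus_fun :> forall i : mprime G, F (mpobj i);
  plus_suppP : plus_supp plus_fun;
  plus_equivP : plus_equiv plus_fun }.

HB.instance Definition _ := gen_eqMixin plus_mod.
HB.instance Definition _ := gen_choiceMixin plus_mod.

Lemma plus_modP (x y : plus_mod) : (forall i, x i = y i) -> x = y.
Proof.
case: x y => [x xs xe] [y ys ye] /= xy.
have e : x = y by exact: functional_extensionality_dep.
by case: y / e ys ye {xy} => ys ye; congr PlusMod.
Qed.

Lemma fext0 (H K : gobj C) f : fext F f (0 : F K) = 0 :> F H.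
Proof. by rewrite /fext; case: pselect => // Df; rewrite linear0. Qed.

Lemma fextD (H K : gobj C) f (x y : F K) :
  fext F f (x + y) = fext F f x + fext F f y :> F H.
Proof. by rewrite /fext; case: pselect => [Df|_]; rewrite ?linearD ?addr0. Qed.

Lemma fextZ (H K : gobj C) f r (x : F K) :
  fext F f (r *: x) = r *: fext F f x :> F H.
Proof. by rewrite /fext; case: pselect => [Df|_]; rewrite ?linearZ ?scaler0. Qed.

Definition plus0 : plus_mod.
Proof.
exists (fun=> 0).
  by rewrite /plus_supp (_ : [set i | _] = set0) // predeqE => i; split.
by move=> g i j _ _; rewrite fext0.
Defined.

Definition plusD (x y : plus_mod) : plus_mod.
Proof.
exists (fun i => x i + y i).
  apply: (@sub_finite_set _ _ ([set i | x i <> 0] `|` [set i | y i <> 0])).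
    move=> i /= xy; have [x0|] := pselect (x i = 0); last by left.
    by right=> y0; apply: xy; rewrite x0 y0 addr0.
  by rewrite finite_setU; split; exact: plus_suppP.
by move=> g i j Gg ij; rewrite fextD -!(plus_equivP _ Gg ij).
Defined.

Definition plusZ (r : R) (x : plus_mod) : plus_mod.
Proof.
exists (fun i => r *: x i).
  apply: (@sub_finite_set _ _ [set i | x i <> 0]); last exact: plus_suppP.
  by move=> i /= + x0; rewrite x0 scaler0.
by move=> g i j Gg ij; rewrite fextZ -(plus_equivP _ Gg ij).
Defined.

Lemma plusDA : associative plusD.
Proof. by move=> x y z; apply: plus_modP => i /=; rewrite addrA. Qed.
Lemma plusDC : commutative plusD.
Proof. by move=> x y; apply: plus_modP => i /=; rewrite addrC. Qed.
Lemma plus0D : left_id plus0 plusD.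
Proof. by move=> x; apply: plus_modP => i /=; rewrite add0r. Qed.
Lemma plusND : left_inverse plus0 (plusZ (- 1)) plusD.
Proof. by move=> x; apply: plus_modP => i /=; rewrite scaleN1r addNr. Qed.

HB.instance Definition _ :=
  GRing.isZmodule.Build plus_mod plusDA plusDC plus0D plusND.

Lemma plusZA r s x : plusZ r (plusZ s x) = plusZ (r * s) x.
Proof. by apply: plus_modP => i /=; rewrite scalerA. Qed.
Lemma plusZ1 : left_id 1 plusZ.
Proof. by move=> x; apply: plus_modP => i /=; rewrite scale1r. Qed.
Lemma plusZDr : right_distributive plusZ +%R.
Proof. by move=> r x y; apply: plus_modP => i /=; rewrite scalerDr. Qed.
Lemma plusZDl x : {morph plusZ^~ x : r s / r + s}.
Proof. by move=> r s; apply: plus_modP => i /=; rewrite scalerDl. Qed.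

HB.instance Definition _ :=
  GRing.Zmodule_isLmodule.Build R plus_mod plusZA plusZ1 plusZDr plusZDl.

End Object.

Definition plus_ob (F : functor D) (G : gobj C) : lmodType R := plus_mod F G.

Section Morphism.
Variables (F : functor D) (G H : gobj C) (U : biset A G H).

(* X is a set of representatives of the (A, H)-orbits of U *)
Definition orbit_reps (X : set U) : Prop :=
  forall v : U, exists! u, X u /\
    exists2 h, h \in H & exists a, v = fact (1%g, h) a u.

(* The pairs (u, (L, lambda)) that contribute to the component at (K, alpha):
   then L = K^u. *)
Definition contributes (i : mprime G) (u : U) (j : mprime H) : Prop :=
  [/\ mdom i \subset dproj1 (mdom (stab_pair u)),
      mdom j = rstar_group (mdom i) (mdom (stab_pair u)),
      lcompat (stab_pair u) j &
      mlstar (mrestr (mdom i) (stab_pair u)) j = i].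

Definition plus_formula (X : set U) (x : plus_ob F H) (i : mprime G) :
    F (mpobj i) :=
  \sum_(w \in [set w : {classic U} * {classic mprime H} |
                 X w.1 /\ contributes i w.1 w.2])
    fext F (trclass R (mpobj i) (mpobj w.2) (mrestr (mdom i) (stab_pair w.1)))
      ((x : plus_mod F H) w.2).

End Morphism.
End Plus.

(* In the situation of the theorem, fext is only applied to morphisms of D. *)
Section FextDomain.
Variables (A : abGroupType) (R : comPzRingType) (C : group_class).
Variable S : pair_family A.
Local Open Scope ring_scope.

Lemma Rspan_gen (V : lmodType R) (X : set V) v : X v -> Rspan X v.
Proof.
by exists [:: (1, v)]; [move=> c; rewrite inE => /eqP ->|rewrite big_seq1 scale1r].
Qed.

Lemma conj_class_hom (G : gobj C) (g : gtype G) (i j : mprime A G) :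
  axiom_i C S -> axiom_ii C S -> axiom_vii C S ->
  g \in G -> mppair j = mconj g (mppair i) ->
  homs R S (mpobj j) (mpobj i) (conj_class A R g (mdom j) (mdom i)).
Proof.
move=> Si Sii Svii Gg ji; have CG := gobjP G.
have Kj : mdom j = (mdom i :^ g^-1)%G by rewrite ji mkpair_dom.
apply: Rspan_gen; exists (mtriv A (conj_graph_group g (mdom i))) => //=.
pose p := mconj (g, 1%g) (mtriv A (diag_group G)).
have pP a b : ((a, b) \in mdom p) = (b \in G) && (a == b ^ g^-1)%g.
  rewrite mkpair_dom mem_conjg invgK.
  have -> : ((a, b) ^ (g, 1) = (a ^ g, b ^ 1))%g by [].
  rewrite conjg1; apply/diagP/andP => /= [[Ga ->]|[Gb /eqP ->]].
    by rewrite Ga conjgK.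
  by rewrite conjgKV.
have pc x : mchi p x = 1%g.
  have [px|] := boolP (x \in mdom p); last exact: mchi_out.
  rewrite mkpair_dom in px; rewrite mkpair_chi ?mtriv_chi // => y z _ _.
  by rewrite !mtriv_chi mulg1.
have Sp : S G G p by apply: Sii => //; [rewrite inE /= Gg group1|exact: Si].
have iG : mdom i \subset dproj2 (mdom p).
  apply/fintype.subsetP => k ik; have Gk := fintype.subsetP (mpsub i) k ik.
  have pk : (k ^ g^-1, k)%g \in mdom p by rewrite pP Gk eqxx.
  by apply/morphimP; exists (k ^ g^-1, k)%g; rewrite ?inE.
have [_ /(_ (mdom i) iG (mpC i)) [_]] := Svii _ _ _ _ _ CG CG Sp.
have -> : lstar_group (mdom p) (mdom i) = mdom j.
  apply/val_inj/setP => x /=; rewrite Kj mem_conjg invgK.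
  apply/lstarP/idP => [[k ik]|ix].
    by rewrite pP => /andP[_ /eqP ->]; rewrite conjgKV.
  by exists (x ^ g)%g => //; rewrite pP (fintype.subsetP (mpsub i)) //= conjgK.
set q := mstar _ _; suff -> : q = mtriv A (conj_graph_group g (mdom i)) by [].
have qd : mdom q = conj_graph_group g (mdom i).
  rewrite mkpair_dom; apply/val_inj/setP => -[a b] /=.
  apply/starP/conj_graphP => /= [[k []]|[ib ->]].
    by rewrite pP => /andP[_ /eqP ->] /diagP[/= ik ->].
  exists b; rewrite pP (fintype.subsetP (mpsub i)) //= eqxx; split=> //.
  by apply/diagP.
apply: mpair_eqP => // -[a b]; rewrite qd => /conj_graphP[/= ib ->].
rewrite (@mstarE _ _ _ _ _ _ _ b).
- by rewrite pc !mtriv_chi mulg1.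
- by move=> h _; rewrite /chi2 /chi1 pc invg1 mtriv_chi.
- by rewrite pP (fintype.subsetP (mpsub i)) //= eqxx.
- by apply/diagP.
Qed.

Lemma mrestr_hom (G H : gobj C) (U : biset A G H) (u : U)
    (i : mprime A G) (j : mprime A H) :
  axiom_viii C S -> splus C S G H (stab_pair u) ->
  contributes i u j ->
  homs R S (mpobj i) (mpobj j)
    (trclass R (mpobj i) (mpobj j) (mrestr (mdom i) (stab_pair u))).
Proof.
move=> Sviii [_ C1 C2 Su] [iu ju _ _]; apply: Rspan_gen.
move: (stab_pair u) C1 C2 Su iu ju => p C1 C2 Su iu ju.
exists (mrestr (mdom i) p) => //.
have [_ /(_ (mdom i) iu (mpC i)) [_]] := Sviii _ _ _ _ _ C1 C2 Su.
rewrite -ju; set q := mstar _ _; suff -> : q = mrestr (mdom i) p by [].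
have restrP a b : ((a, b) \in mdom (mrestr (mdom i) p)) =
    ((a, b) \in mdom p) && (a \in mdom i).
  by rewrite mkpair_dom !inE /= andbT.
have qd : mdom q = mdom (mrestr (mdom i) p).
  rewrite mkpair_dom; apply/val_inj/setP => -[a b] /=; rewrite restrP.
  apply/starP/andP => /= [[k [/diagP[/= ia ->] pk]]|[pab ia]] //.
  by exists a; split=> //; apply/diagP.
apply: mpair_eqP => // -[a b]; rewrite qd restrP => /andP[pab ia].
have comp_p : compat (mtriv A (diag_group (mdom i))) p.
  move=> h; rewrite !inE => /andP[/diagP[/= _ ->]] _.
  by rewrite /chi2 /chi1 !mchi1 invg1.
rewrite (mstarE comp_p (h := a)) //; last by apply/diagP.
rewrite mkpair_chi.
- by rewrite mtriv_chi mul1g.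
- by move=> x y; rewrite !inE => /andP[px _] /andP[py _]; exact: mchiM.
- by rewrite !inE pab /= ia.
Qed.
End FextDomain.

(* Main.v *)
(* For u in U and (K, alpha), at most one (K^u, lambda) contributes to the
   component at (K, alpha), since alpha = phi_u * lambda determines lambda; so
   F^+([U]) is a sum over the (A, H)-orbits of U of orbit-invariant terms, and
   it is defined for every fibered biset U and extends to all of B^A_R(G, H).
   Functoriality rests on two facts.  As k_2 is trivial on S, every pair (u, v)
   is free, and representatives u in [A\U/H], v in [A\V/K] give representatives
   u (x) v of A\(U (x) V)/K; a contribution of u (x) v factors through a unique
   contribution of u followed by one of v, because the h with (g, h) in the
   stabilizer of u is determined by g.  The corresponding restricted pairs
   compose in the source category without a sum, since the Mackey formula has a
   single double coset when p_2 of the left factor is the whole group. *)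
Require Import Defs.
From HB Require Import structures.
From mathcomp Require Import all_boot all_fingroup all_algebra.
From mathcomp Require Import boolp classical_sets functions cardinality fsbigop.

Set Implicit Arguments.
Unset Strict Implicit.
Unset Printing Implicit Defensive.

Import GRing.Theory.

Local Open Scope classical_set_scope.
Local Open Scope group_scope.

(** Every summand of F^+([U]) is written as [term s i x], which depends on U only through a pair s.
    The formula for F^+ thus becomes a calculus of pairs under [mstar]. Conjugation belongs to it as
    composition with a conjugation graph [cpair], so that independence of the representative,
    equivariance of the resulting family and functoriality all rest on one composition lemma,
    [good_mstar]. The obstacle is that the axioms speak only of subgroups in the given class, while
    the pairs that occur may project onto other subgroups. Membership in S is therefore asked only
    of the restriction of s to some K in the class; a contributing restriction projects onto K and
    onto K * s, and there the axioms apply. Working on the whole of B^A_R(G, H) also settles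
    well-definedness: elements of the span of S^+ have many expressions, and none has to be
    chosen. *)

(** * Pairs: conjugation, restriction, composition, transport of characters *)

Section Pairs.
Variable A : abGroupType.
Implicit Types gT hT kT : finGroupType.

Lemma mpair_ext gT (p q : mpair A gT) :
  (forall x, (x \in mdom p) = (x \in mdom q)) ->
  (forall x, x \in mdom p -> mchi p x = mchi q x) -> p = q.
Proof. by move=> pq; apply: mpair_eqP; apply/val_inj/setP. Qed.

Lemma mem_mconj gT (x y : gT) (p : mpair A gT) :
  (y \in mdom (mconj x p)) = (y ^ x \in mdom p).
Proof. by rewrite mkpair_dom mem_conjg invgK. Qed.

Lemma mconj_chi gT (x y : gT) (p : mpair A gT) :
  mchi (mconj x p) y = mchi p (y ^ x).
Proof.
have [py|npy] := boolP (y ^ x \in mdom p); last first.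
  by rewrite !mchi_out ?mem_mconj.
rewrite mkpair_chi ?mem_conjg ?invgK // => a b; rewrite !mem_conjg !invgK.
by move=> pa pb; rewrite conjMg mchiM.
Qed.

Lemma mconjM gT (x y : gT) (p : mpair A gT) :
  mconj (x * y) p = mconj x (mconj y p).
Proof.
apply: mpair_ext => [z|z _]; first by rewrite !mem_mconj conjgM.
by rewrite !mconj_chi conjgM.
Qed.

Lemma mconj1 gT (p : mpair A gT) : mconj 1 p = p.
Proof.
apply: mpair_ext => [z|z _]; first by rewrite mem_mconj conjg1.
by rewrite mconj_chi conjg1.
Qed.

Definition mconj2 gT hT (g : gT) (h : hT) (p : mpair A (gT * hT)%type) :
  mpair A (gT * hT)%type := mconj (g, h) p.

Lemma mem_mconj2 gT hT (g : gT) (h : hT) (p : mpair A (gT * hT)%type) x :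
  (x \in mdom (mconj2 g h p)) = ((x.1 ^ g, x.2 ^ h) \in mdom p).
Proof. by case: x => a b; exact: mem_mconj. Qed.

Lemma mconj2_chi gT hT (g : gT) (h : hT) (p : mpair A (gT * hT)%type) x :
  mchi (mconj2 g h p) x = mchi p (x.1 ^ g, x.2 ^ h).
Proof. by case: x => a b; exact: mconj_chi. Qed.

Lemma dproj1P gT hT (D : {group gT * hT}) g :
  reflect (exists h, (g, h) \in D) (g \in dproj1 D).
Proof.
apply: (iffP morphimP) => [[[a h] _ Dx ->]|[h Dx]]; first by exists h.
by exists (g, h); rewrite ?inE.
Qed.

Lemma dproj2P gT hT (D : {group gT * hT}) h :
  reflect (exists g, (g, h) \in D) (h \in dproj2 D).
Proof.
apply: (iffP morphimP) => [[[g b] _ Dx ->]|[g Dx]]; first by exists g.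
by exists (g, h); rewrite ?inE.
Qed.

Lemma mem_mrestr gT hT (K : {group gT}) (p : mpair A (gT * hT)%type) x :
  (x \in mdom (mrestr K p)) = (x \in mdom p) && (x.1 \in K).
Proof. by rewrite mkpair_dom !inE andbT. Qed.

Lemma mrestr_chi gT hT (K : {group gT}) (p : mpair A (gT * hT)%type) x :
  x.1 \in K -> mchi (mrestr K p) x = mchi p x.
Proof.
move=> Kx; have [px|npx] := boolP (x \in mdom p); last first.
  by rewrite !mchi_out ?mem_mrestr ?(negbTE npx).
rewrite mkpair_chi ?inE ?px ?Kx // => a b.
by rewrite !inE => /andP[pa _] /andP[pb _]; rewrite mchiM.
Qed.

Lemma mrestr_lcompat gT hT (K : {group gT}) (p : mpair A (gT * hT)%type) l :
  lcompat p l -> lcompat (mrestr K p) l.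
Proof.
move=> pl h; rewrite !inE mem_mrestr => /andP[/andP[ph _] lh].
by rewrite /chi2 mrestr_chi /= ?group1 // -[LHS]/(chi2 p h) pl // !inE ph.
Qed.

Lemma compat_trivl gT hT kT (p : mpair A (gT * hT)%type)
    (q : mpair A (hT * kT)%type) : ker2 (mdom p) = [set 1]%SET -> compat p q.
Proof.
move=> p1 h; rewrite p1 !inE => /andP[/eqP -> _].
by rewrite /chi2 /chi1 !mchi1 invg1.
Qed.

Lemma mem_mstar gT hT kT (p : mpair A (gT * hT)%type)
    (q : mpair A (hT * kT)%type) g k :
  reflect (exists h, (g, h) \in mdom p /\ (h, k) \in mdom q)
          ((g, k) \in mdom (mstar p q)).
Proof. by rewrite mkpair_dom; exact: (starP _ _ (g, k)). Qed.

(** A way to identify a composite that avoids the choice of a middle element in the definition of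
    [mstar]. *)
Lemma mstar_uniq gT hT kT (p : mpair A (gT * hT)%type)
    (q : mpair A (hT * kT)%type) (r : mpair A (gT * kT)%type) :
  compat p q ->
  (forall g h k, (g, h) \in mdom p -> (h, k) \in mdom q ->
     (g, k) \in mdom r /\ mchi r (g, k) = mchi p (g, h) * mchi q (h, k)) ->
  (forall g k, (g, k) \in mdom r ->
     exists h, (g, h) \in mdom p /\ (h, k) \in mdom q) ->
  mstar p q = r.
Proof.
move=> pq pqr rpq; apply: mpair_ext => -[g k].
  by apply/mem_mstar/idP => [[h [/pqr gh /gh []]]|/rpq].
by case/mem_mstar => h [ph qh]; rewrite (mstarE pq ph qh); case: (pqr _ _ _ ph qh).
Qed.

(* For [p = stab_pair u] this says that [(u, j)] contributes to the component
   at [i]; [lcompat] is the case [g = 1] of the last condition. *)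
Definition transports gT hT (p : mpair A (gT * hT)%type) (i : mpair A gT)
    (j : mpair A hT) : Prop :=
  [/\ forall g, g \in mdom i -> exists h, (g, h) \in mdom p,
      forall h, h \in mdom j -> exists2 g, g \in mdom i & (g, h) \in mdom p,
      forall g h, g \in mdom i -> (g, h) \in mdom p -> h \in mdom j &
      forall g h, g \in mdom i -> (g, h) \in mdom p ->
        mchi i g = mchi p (g, h) * mchi j h].

Lemma transportsP gT hT (p : mpair A (gT * hT)%type) i j :
  [/\ mdom i \subset dproj1 (mdom p),
      mdom j = rstar_group (mdom i) (mdom p),
      lcompat p j & mlstar (mrestr (mdom i) p) j = i] <-> transports p i j.
Proof.
split.
  move=> [/fintype.subsetP ip jE pj iE].
  have lp g h : g \in mdom i -> (g, h) \in mdom p -> h \in mdom j.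
    by move=> ig pgh; rewrite jE; apply/rstarP; exists g.
  have compl := mrestr_lcompat (K := mdom i) pj.
  split=> [g|h|g h|g h].
  - by move/ip/dproj1P.
  - by rewrite jE => /rstarP[g ig pgh]; exists g.
  - exact: lp.
  - move=> ig pgh; rewrite -{1}iE.
    rewrite (mlstarE compl (k := h)) ?mem_mrestr ?pgh ?(lp g) //.
    by rewrite mrestr_chi.
move=> [i1 i2 i3 i4].
have jE : mdom j = rstar_group (mdom i) (mdom p).
  apply/val_inj/setP => h /=; apply/idP/rstarP => [/i2|] [g ig pgh].
    by exists g.
  exact: i3 pgh.
have pj : lcompat p j.
  move=> h; rewrite !inE => /andP[ph jh]; have := i4 1 h (group1 _) ph.
  by rewrite mchi1 /chi2 => /esym/mulg1_eq.
split=> //; first by apply/fintype.subsetP => g /i1 ?; apply/dproj1P.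
have compl := mrestr_lcompat (K := mdom i) pj.
apply: mpair_ext => g.
  rewrite mkpair_dom; apply/lstarP/idP => [[h _]|ig].
    by rewrite mem_mrestr => /andP[].
  have [h pgh] := i1 _ ig; exists h; first exact: i3 pgh.
  by rewrite mem_mrestr pgh.
rewrite mkpair_dom => /lstarP[h jh ph].
rewrite (mlstarE compl ph jh); move: ph; rewrite mem_mrestr => /andP[pgh /= ig].
by rewrite mrestr_chi // -i4.
Qed.

Lemma transports_uniq gT hT (p : mpair A (gT * hT)%type) i j j' :
  transports p i j -> transports p i j' -> j = j'.
Proof.
move=> [i1 i2 i3 i4] [j1 j2 j3 j4]; apply: mpair_ext => h.
  apply/idP/idP => [/i2|/j2] [g ig pgh]; [exact: j3 pgh|exact: i3 pgh].
move=> /i2[g ig pgh]; apply: (mulgI (mchi p (g, h))).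
by rewrite -i4 // -j4.
Qed.

(** All four conditions look at p over [mdom i] only. This allows a composite with a conjugation
    graph to be exchanged for a conjugate, since these agree only after restriction. *)
Lemma transports_mrestr gT hT (p p' : mpair A (gT * hT)%type) i j :
  mrestr (mdom i) p = mrestr (mdom i) p' -> transports p i j ->
  transports p' i j.
Proof.
move=> pp'.
have dE g h : g \in mdom i -> ((g, h) \in mdom p') = ((g, h) \in mdom p).
  move=> ig; have := congr1 (fun q => (g, h) \in mdom q) pp'.
  by rewrite !mem_mrestr /= ig !andbT.
have cE g h : g \in mdom i -> mchi p' (g, h) = mchi p (g, h).
  move=> ig; rewrite -[LHS](mrestr_chi (K := mdom i)) //.
  by rewrite -[RHS](mrestr_chi (K := mdom i)) // pp'.
move=> [i1 i2 i3 i4]; split=> [g ig|h /i2[g ig pgh]|g h ig|g h ig].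
- by have [h pgh] := i1 g ig; exists h; rewrite dE.
- by exists g; rewrite // dE.
- by rewrite dE //; exact: i3.
- by rewrite dE // cE //; exact: i4.
Qed.

Section Composition.
Variables gT hT kT : finGroupType.
Variables (p : mpair A (gT * hT)%type) (q : mpair A (hT * kT)%type).
Variables (i : mpair A gT) (j : mpair A hT) (k : mpair A kT).
Hypotheses (pij : transports p i j) (qjk : transports q j k).

(** If (1, h) is in p and (h, 1) is in q, transport gives 1 = p(1, h) j(h) and j(h) = q(h, 1), which
    is the compatibility at h. *)
Lemma transports_compat : compat p q.
Proof.
case: pij qjk => [_ _ i3 i4] [_ _ _ j4] h; rewrite !inE => /andP[ph qh].
have jh := i3 1 h (group1 _) ph; have := i4 _ _ (group1 _) ph.
by rewrite (j4 _ _ jh qh) !mchi1 mulg1 => /esym/mulg1_eq.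
Qed.

Lemma transports_mstar : transports (mstar p q) i k.
Proof.
have pq := transports_compat.
case: (pij) (qjk) => [i1 i2 i3 i4] [j1 j2 j3 j4].
split=> [g ig|c /j2[h /i2[g ig pgh] qhc]|g c ig|g c ig].
- have [h pgh] := i1 g ig; have [c qhc] := j1 h (i3 _ _ ig pgh).
  by exists c; apply/mem_mstar; exists h.
- by exists g => //; apply/mem_mstar; exists h.
- case/mem_mstar => h [pgh qhc]; exact: j3 (i3 _ _ ig pgh) qhc.
- case/mem_mstar => h [pgh qhc]; rewrite (mstarE pq pgh qhc).
  by rewrite -mulgA -j4 -?i4 // (i3 g).
Qed.

(** An h matched by p with an element of [mdom i] lies in [mdom j], so restricting q to [mdom j]
    removes nothing from the composite over [mdom i]. *)
Lemma mrestr_mstar : mstar (mrestr (mdom i) p) (mrestr (mdom j) q) =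
  mrestr (mdom i) (mstar p q).
Proof.
have pq := transports_compat; case: (pij) => [i1 i2 i3 i4].
have rpq : compat (mrestr (mdom i) p) (mrestr (mdom j) q).
  move=> h; rewrite !inE !mem_mrestr /= group1 andbT => /andP[ph /andP[qh jh]].
  rewrite /chi2 /chi1 !mrestr_chi /= ?group1 //.
  by rewrite -[LHS]/(chi2 p h) -[RHS]/(chi1 q h) pq // !inE ph qh.
apply: mstar_uniq => // [g h c|g c]; rewrite !mem_mrestr /=.
  move=> /andP[pgh ig] /andP[qhc jh]; rewrite !mrestr_chi // ig andbT.
  by rewrite (mstarE pq pgh qhc); split=> //; apply/mem_mstar; exists h.
move=> /andP[/mem_mstar[h [pgh qhc]] ig]; exists h.
by rewrite !mem_mrestr pgh qhc /= ig (i3 g).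
Qed.

End Composition.

(* As k_2(p) = 1, the h with (g, h) in p is determined by g, so j can be read off
   from q and k alone. *)
Lemma transports_split gT hT kT (p : mpair A (gT * hT)%type)
    (q : mpair A (hT * kT)%type) i k :
  ker2 (mdom p) = [set 1]%SET -> transports (mstar p q) i k ->
  exists2 j, transports p i j & transports q j k.
Proof.
move=> p1 [w1 w2 w3 w4]; have pq := compat_trivl (q := q) p1.
have uniqh g h h' : (g, h) \in mdom p -> (g, h') \in mdom p -> h = h'.
  move=> pgh pgh'; have: h^-1 * h' \in ker2 (mdom p).
    by rewrite inE; have := groupM (groupVr pgh) pgh'; rewrite pairV pairM mulVg.
  by rewrite p1 inE -eq_mulVg1 => /eqP.
have qk : lcompat q k.
  move=> c; rewrite !inE => /andP[qc kc].
  have wc : (1, c) \in mdom (mstar p q).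
    by apply/mem_mstar; exists 1; split=> //; exact: group1.
  have := w4 _ _ (group1 _) wc; rewrite (mstarE pq (group1 _) qc) mchi1.
  by rewrite [mchi p _](mchi1 p) mul1g => /esym/mulg1_eq.
(* The only candidate: p forces the domain, q and k force the values. [mlstar q k] may live on a
   larger group, whence the restriction. *)
pose j := mkpair (rstar_group (mdom i) (mdom p)) (mchi (mlstar q k)).
have jP h : reflect (exists2 g, g \in mdom i & (g, h) \in mdom p) (h \in mdom j).
  by rewrite mkpair_dom; exact: rstarP.
(* An element c paired with g in the composite passes through some middle element, which must be the
   given h by [uniqh]. *)
have ext g h : g \in mdom i -> (g, h) \in mdom p ->
    exists c, [/\ (h, c) \in mdom q, c \in mdom k & (g, c) \in mdom (mstar p q)].
  move=> ig pgh; have [c wgc] := w1 g ig; exists c; rewrite (w3 g) //; split=> //.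
  by case/mem_mstar: wgc => h' [/(uniqh _ _ _ pgh) ->].
have jl h : h \in mdom j -> h \in mdom (mlstar q k).
  move=> /jP[g ig pgh]; have [c [qhc kc _]] := ext g h ig pgh.
  by rewrite mkpair_dom; apply/lstarP; exists c.
have jE h : h \in mdom j -> mchi j h = mchi (mlstar q k) h.
  move=> jh; apply: mkpair_chi; last by rewrite mkpair_dom in jh.
  move=> a b ja jb; apply: mchiM; apply: jl; first by rewrite mkpair_dom.
  by rewrite mkpair_dom.
exists j.
  split=> [g ig|h /jP|g h ig pgh|g h ig pgh] //.
  - by have [c /mem_mstar[h [pgh _]]] := w1 g ig; exists h.
  - by apply/jP; exists g.
  - have [c [qhc kc wgc]] := ext g h ig pgh.
    rewrite jE; last by apply/jP; exists g.
    by rewrite (mlstarE qk qhc kc) (w4 _ _ ig wgc) (mstarE pq pgh qhc) mulgA.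
split=> [h /jP[g ig pgh]|c /w2[g ig /mem_mstar[h [pgh qhc]]]|h c|h c].
- by have [c [qhc _ _]] := ext g h ig pgh; exists c.
- by exists h => //; apply/jP; exists g.
- by move=> /jP[g ig pgh] qhc; apply: (w3 g) => //; apply/mem_mstar; exists h.
- move=> jh qhc; rewrite jE //; apply: mlstarE => //; have /jP[g ig pgh] := jh.
  by apply: (w3 g) => //; apply/mem_mstar; exists h.
Qed.

(** The graph of the conjugation from K to its conjugate by g, with the conjugate on the left; it is
    the pair underlying [conj_class]. *)
Definition cpair gT (g : gT) (K : {group gT}) : mpair A (gT * gT)%type :=
  mtriv A (conj_graph_group g K).

Lemma mem_cpair gT (g : gT) (K : {group gT}) a b :
  ((a, b) \in mdom (cpair g K)) = (b \in K) && (a == b ^ g^-1).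
Proof. by apply/conj_graphP/andP => /= -[-> /eqP]. Qed.

Lemma compat_cpairl gT hT (g : gT) (K : {group gT})
    (p : mpair A (gT * hT)%type) : compat (cpair g K) p.
Proof.
move=> h; rewrite !inE mem_cpair => /andP[/andP[_ /eqP h1] _].
have -> : h = 1 by rewrite -[h](conjgKV g) -h1 conj1g.
by rewrite /chi2 /chi1 !mchi1 invg1.
Qed.

Lemma compat_cpairr gT hT (h : hT) (K : {group hT})
    (p : mpair A (gT * hT)%type) : compat p (cpair h K).
Proof.
move=> x; rewrite !inE mem_cpair => /andP[_ /andP[_ /eqP ->]].
by rewrite conj1g /chi2 /chi1 !mchi1 invg1.
Qed.

Lemma transports_cpair gT (g : gT) (i : mpair A gT) :
  transports (cpair g (mdom i)) (mconj g i) i.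
Proof.
split=> [a|b ib|a b|a b].
- by rewrite mem_mconj => ia; exists (a ^ g); rewrite mem_cpair ia conjgK eqxx.
- by exists (b ^ g^-1); rewrite ?mem_mconj ?mem_cpair ?conjgKV ?ib ?eqxx.
- by rewrite mem_cpair => _ /andP[].
- move=> _; rewrite mem_cpair => /andP[ib /eqP ->].
  by rewrite mtriv_chi mul1g mconj_chi conjgKV.
Qed.

Lemma mrestr_cpair gT (g : gT) (K L : {group gT}) : K :^ g^-1 = L ->
  mrestr L (cpair g K) = cpair g K.
Proof.
move=> KL; apply: mpair_ext => -[a b].
  rewrite mem_mrestr; apply/andP/idP => [[]//|cab]; split=> //.
  move: cab; rewrite mem_cpair => /andP[Kb /eqP ->].
  by rewrite -KL memJ_conjg.
by rewrite mem_mrestr => /andP[_ /= La]; rewrite mrestr_chi.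
Qed.

(** The graph meets p only over [mdom i], so the composite is in general smaller than the conjugate
    of p; over the conjugate of [mdom i] nothing is lost. *)
Lemma mrestr_mconjl gT hT (g : gT) (i : mpair A gT)
    (p : mpair A (gT * hT)%type) :
  mrestr (mdom (mconj g i)) (mstar (cpair g (mdom i)) p) =
  mrestr (mdom (mconj g i)) (mconj2 g 1 p).
Proof.
have memE a b : a ^ g \in mdom i ->
    ((a, b) \in mdom (mstar (cpair g (mdom i)) p)) = ((a ^ g, b) \in mdom p).
  move=> ia; apply/mem_mstar/idP => [[h []]|pab].
    by rewrite mem_cpair => /andP[_ /eqP ->]; rewrite conjgKV.
  by exists (a ^ g); rewrite mem_cpair conjgK eqxx ia.
apply: mpair_ext => -[a b]; rewrite !mem_mrestr /=.
  rewrite mem_mconj2 mem_mconj /= conjg1.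
  by case ia: (a ^ g \in mdom i); rewrite ?andbF // memE.
rewrite mem_mconj => /andP[wab ia]; rewrite memE // in wab.
rewrite !mrestr_chi /= ?mem_mconj // mconj2_chi /= conjg1.
rewrite (mstarE (@compat_cpairl _ _ _ _ _) (h := a ^ g)) ?mtriv_chi ?mul1g //.
by rewrite mem_cpair conjgK ia eqxx.
Qed.

(** The graph of conjugation by h^-1 has [mdom j] on the left and its conjugate by h on the right.
    Transport puts the second components of p over [mdom i] into [mdom j], where the graph meets
    them. *)
Lemma mrestr_mconjr gT hT (h : hT) (i : mpair A gT) (j : mpair A hT)
    (p : mpair A (gT * hT)%type) : transports p i j ->
  mrestr (mdom i) (mstar p (cpair h^-1 (mdom (mconj h j)))) =
  mrestr (mdom i) (mconj2 1 h p).
Proof.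
move=> [_ _ i3 _].
have memE a b : a \in mdom i -> ((a, b) \in mdom (mstar p
    (cpair h^-1 (mdom (mconj h j))))) = ((a, b ^ h) \in mdom p).
  move=> ia; apply/mem_mstar/idP => [[c []]|pab].
    by rewrite mem_cpair invgK => pac /andP[_ /eqP <-].
  by exists (b ^ h); rewrite mem_cpair mem_mconj invgK eqxx (i3 a).
apply: mpair_ext => -[a b]; rewrite !mem_mrestr /=.
  rewrite mem_mconj2 /= conjg1.
  by case ia: (a \in mdom i); rewrite ?andbF // memE.
move=> /andP[wab ia]; rewrite memE // in wab.
rewrite !mrestr_chi // mconj2_chi /= conjg1.
rewrite (mstarE (@compat_cpairr _ _ _ _ _) (h := b ^ h)) ?mtriv_chi ?mulg1 //.
by rewrite mem_cpair mem_mconj (i3 a) //= invgK.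
Qed.

End Pairs.

(** * Stabilizing pairs of elements of a fibered set *)

Section Stabilizers.
Variables (A : abGroupType) (gT : finGroupType) (G : {group gT}).
Implicit Types U V : fibset A G.

Lemma stab_uniq U (u : U) (p : mpair A gT) :
  (forall x, x \in mdom p -> x \in G /\ fact x 1 u = fact 1 (mchi p x) u) ->
  (forall x a, x \in G -> fact x 1 u = fact 1 a u -> x \in mdom p) ->
  stab_pair u = p.
Proof.
move=> pu up; apply: mpair_ext => x.
  rewrite mkpair_dom; apply/fstabP/idP => [[Gx [a]]|px]; first exact: up.
  by have [Gx xu] := pu x px; split=> //; exists (mchi p x).
rewrite mkpair_dom => xu; have xuE := stab_pairE xu.
have [Gx [a xa]] := fstabP _ _ xu.
have [_] := pu x (up x a Gx xa); rewrite xuE; exact: ffree2.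
Qed.

Lemma mem_stabP U (u : U) x :
  reflect (x \in G /\ exists a, fact x 1 u = fact 1 a u)
    (x \in mdom (stab_pair u)).
Proof. by rewrite mkpair_dom; exact: fstabP. Qed.

Lemma stabE U (u : U) x :
  x \in mdom (stab_pair u) -> fact x 1 u = fact 1 (mchi (stab_pair u) x) u.
Proof. by rewrite mkpair_dom; exact: stab_pairE. Qed.

Lemma stab_sub U (u : U) : mdom (stab_pair u) \subset G.
Proof. by apply/fintype.subsetP => x /mem_stabP[]. Qed.

Lemma stab_chi U (u : U) x a : x \in G -> fact x 1 u = fact 1 a u ->
  mchi (stab_pair u) x = a.
Proof.
move=> Gx xu; have xs : x \in mdom (stab_pair u).
  by apply/mem_stabP; split=> //; exists a.
by apply: (@ffree2 _ _ _ _ _ _ u); rewrite -stabE.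
Qed.

Lemma factK U x a (u : U) : x \in G -> fact x^-1 a^-1 (fact x a u) = u.
Proof. by move=> Gx; rewrite -factM ?groupV // !mulVg fact1. Qed.

Lemma fact_inj U x a : x \in G -> injective (@fact _ _ _ U x a).
Proof. by move=> Gx u v /(congr1 (fact x^-1 a^-1)); rewrite !factK. Qed.

(** The scalar a leaves no trace because A is abelian and its action commutes with that of G. *)
Lemma stab_fact U x a (u : U) : x \in G ->
  stab_pair (fact x a u) = mconj x (stab_pair u).
Proof.
move=> Gx; have eqv y c : y \in G -> fact y 1 (fact x a u) = fact 1 c (fact x a u)
    <-> fact (y ^ x) 1 u = fact 1 c u.
  move=> Gy; rewrite conjgE.
  have -> : fact (x^-1 * (y * x)) 1 u = fact x^-1 a^-1 (fact y 1 (fact x a u)).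
    by rewrite -!factM ?groupM ?groupV // mulg1 mulVg mulgA.
  have -> : fact 1 c u = fact x^-1 a^-1 (fact 1 c (fact x a u)).
    rewrite -!factM ?groupM ?groupV // mulg1 mulVg.
    by rewrite -mulgA (abmulgC c) mulKg.
  by split=> [->|/fact_inj ->] //; rewrite ?groupV.
apply: stab_uniq => [y|y b Gy].
  rewrite mem_mconj => yxs; have Gy : y \in G.
    by have := fintype.subsetP (stab_sub u) _ yxs; rewrite groupJr.
  by split=> //; apply/eqv => //; rewrite mconj_chi -stabE.
move/eqv => /(_ Gy) yxu; rewrite mem_mconj; apply/mem_stabP.
by rewrite groupJr //; split=> //; exists b.
Qed.

Lemma stab_equivariant U V (f : U -> V) u :
  equivariant f -> injective f -> stab_pair (f u) = stab_pair u.
Proof.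
move=> fE fI; apply: stab_uniq => [x xu|x a Gx].
  have Gx := fintype.subsetP (stab_sub u) _ xu.
  by split=> //; rewrite -!fE // stabE.
by rewrite -!fE // => /fI xu; apply/mem_stabP; split=> //; exists a.
Qed.

End Stabilizers.

(** * Transitive fibered sets as orbits *)

Section TransitiveSets.
Variables (A : abGroupType) (gT : finGroupType) (G : {group gT}).

(** The element (d, phi(d)^-1) belongs to the subgroup whose cosets are taken. *)
Lemma tcoset_stab (p : mpair A gT) d :
  d \in mdom p -> tcoset p d (mchi p d)^-1 = tcoset p 1 1.
Proof.
move=> pd; apply/seteqP; split=> _ [e pe ->].
  by exists (d * e); [exact: groupM|rewrite mul1g mul1g mchiM // invMg abmulgC].
exists (d^-1 * e); first by rewrite groupM ?groupV.
rewrite mulKVg mul1g mul1g; congr pair.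
have -> : mchi p e = mchi p d * mchi p (d^-1 * e).
  by rewrite -mchiM ?groupM ?groupV // mulKVg.
by rewrite invMg abmulgC.
Qed.

(** This is the orbit map sending the coset of (g, a) to (g, a) u. Surjectivity is claimed onto the
    orbit of u only, which is the form needed to split U into orbits. *)
Lemma transitive_embed (U : fibset A G) (u : U) :
  exists f : transitive_set G (stab_pair u) -> U,
    [/\ equivariant f, injective f &
        forall x a, x \in G -> exists c, f c = fact x a u].
Proof.
set p := stab_pair u.
have pG d : d \in mdom p -> d \in G by exact/fintype.subsetP/stab_sub.
have wd g g' a a' : g \in G -> g' \in G -> tcoset p g a = tcoset p g' a' ->
    fact g a u = fact g' a' u.
  move=> Gg Gg' e; have : tcoset p g a (frank g, a).
    by exists 1; rewrite ?group1 // mchi1 invg1 !mulg1.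
  rewrite e => -[d pd [/(can_inj (@frankK _)) -> ->]].
  rewrite (factM _ _ _ Gg' (pG d pd)).
  by congr fact; rewrite (Defs.factE _ _ (pG _ pd)) (stabE pd) -factMr mulVg fact1.
have rep (c : transitive_set G p) : exists ga : gT * A,
    ga.1 \in G /\ sval c = tcoset p ga.1 ga.2.
  by have [g Gg [a ca]] := svalP c; exists (g, a).
pose r c := sval (cid (rep c)).
have rG c : (r c).1 \in G by have [] := svalP (cid (rep c)).
have rE c : sval c = tcoset p (r c).1 (r c).2 by have [] := svalP (cid (rep c)).
pose f c := fact (r c).1 (r c).2 u.
have fE c g a : g \in G -> sval c = tcoset p g a -> f c = fact g a u.
  by move=> Gg ca; apply: wd; rewrite // -rE.
exists f; split.
- move=> x a c Gx; rewrite /f -factM //; apply: fE; first exact: groupM.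
  by rewrite tactE // rE tshift_coset.
- move=> c c'; rewrite /f => e; apply: tcar_inj; rewrite (rE c) (rE c').
  set g := (r c).1 in e *; set g' := (r c').1 in e *.
  set a := (r c).2 in e *; set a' := (r c').2 in e *.
  have Gd : g'^-1 * g \in G by rewrite groupM ?groupV ?rG.
  have du : fact (g'^-1 * g) 1 u = fact 1 (a^-1 * a') u.
    apply: (@fact_inj _ _ _ U g' a); first exact: rG.
    by rewrite -!factM ?group1 ?rG // !mulKVg !mulg1.
  have pd : g'^-1 * g \in mdom p.
    by apply/mem_stabP; split=> //; exists (a^-1 * a').
  have ca := stab_chi Gd du.
  have -> : tcoset p g' a' = tshift g' a' (tcoset p 1 1).
    by rewrite tshift_coset !mulg1.
  rewrite -(tcoset_stab pd) tshift_coset mulKVg; congr tcoset.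
  by rewrite ca invMg invgK mulKVg.
- move=> x a Gx; pose c0 : transitive_set G p :=
    exist _ (tcoset p x a) (ex_intro2 _ _ x Gx (ex_intro _ a erefl)).
  by exists c0; exact: fE.
Qed.

Lemma transitive_iso (U : fibset A G) (u : U) :
  (forall v, exists2 x, x \in G & exists a, v = fact x a u) ->
  fiso (transitive_set G (stab_pair u)) U.
Proof.
move=> tU; have [f [fE fI fS]] := transitive_embed u.
exists f; last by move=> x a c; exact: fE.
apply: inj_surj_bij => // v; have [x Gx [a ->]] := tU v; exact: fS.
Qed.

Definition tbase (p : mpair A gT) : transitive_set G p :=
  exist _ (tcoset p 1 1)
    (ex_intro2 _ _ 1 (group1 G) (ex_intro _ 1 erefl)).

Lemma tbase_transitive (p : mpair A gT) (c : transitive_set G p) :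
  exists2 x, x \in G & exists a, c = fact x a (tbase p).
Proof.
have [g Gg [a ca]] := svalP c; exists g => //; exists a.
by apply: tcar_inj; rewrite tactE //= tshift_coset !mulg1.
Qed.

Lemma stab_tbase (p : mpair A gT) :
  mdom p \subset G -> stab_pair (tbase p) = p.
Proof.
move=> /fintype.subsetP pG; apply: stab_uniq => [x px|x a Gx].
  have Gx := pG _ px; split=> //; apply: tcar_inj.
  rewrite !tactE //= !tshift_coset !mulg1.
  have := tshift_coset p 1 (mchi p x) x (mchi p x)^-1.
  by rewrite tcoset_stab // tshift_coset mulgV !mul1g !mulg1 => ->.
move=> /(congr1 sval); rewrite !tactE //= !tshift_coset !mulg1 => e.
have : tcoset p x 1 (frank x, 1).
  by exists 1; rewrite ?group1 // mchi1 invg1 !mulg1.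
by rewrite e => -[d pd [/(can_inj (@frankK _)) -> _]]; rewrite mul1g.
Qed.

End TransitiveSets.

(** * Decomposition of a fibered biset into transitive ones *)

Section EmptySet.
Variables (A : abGroupType) (gT : finGroupType) (G : {group gT}).

Let act (x : gT) (a : A) (u : void) : void := u.

Lemma void_fin : finite_set (range (fun u => range (fun a => act 1 a u))).
Proof.
by rewrite (_ : range _ = set0) // predeqE => c; split=> // -[[]].
Qed.

Definition fib0 : fibset A G :=
  @FibSet A gT G void act (fun u => erefl) (fun _ _ _ _ u _ _ => erefl)
    (fun a (u : void) _ => match u with end) void_fin.

End EmptySet.

Section Decomposition.
Variables (A : abGroupType) (R : comPzRingType).
Variables (gT hT : finGroupType) (G : {group gT}) (H : {group hT}).
Local Open Scope ring_scope.

(** The empty biset E is isomorphic to the disjoint union of two copies of itself, so its class e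
    satisfies e + e = e. *)
Lemma bclass0 : bclass R (fib0 A (setX_group G H) : biset A G H) = 0.
Proof.
set E := fib0 _ _; apply: (addrI (bclass R (E : biset A G H))).
rewrite addr0 -bclass_sum; apply/esym/bclass_iso.
exists (fun u : E => inl u) => [|x a []] //.
by exists (fun w => match w with inl u | inr u => u end) => [[]|[[]|[]]].
Qed.

Lemma Rspan0 (V : lmodType R) (X : set V) : Rspan X 0.
Proof. by exists [::]; rewrite ?big_nil. Qed.

Lemma RspanD (V : lmodType R) (X : set V) v w :
  Rspan X v -> Rspan X w -> Rspan X (v + w).
Proof.
move=> [s sX ->] [t tX ->]; exists (s ++ t); last by rewrite big_cat.
by move=> c; rewrite mem_cat => /orP[/sX|/tX].
Qed.

Lemma Rspan_ind (V : lmodType R) (X : set V) (P : V -> Prop) :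
  P 0 -> (forall r v w, X v -> P w -> P (r *: v + w)) ->
  forall v, Rspan X v -> P v.
Proof.
move=> P0 PD v [s sX ->]; elim: s sX => [|c s IHs] sX; rewrite ?big_nil //.
rewrite big_cons; apply: PD; first by apply: sX; rewrite mem_head.
by apply: IHs => d ds; apply: sX; rewrite inE ds orbT.
Qed.

(** Orbits are added one at a time. If u is not yet in the image, its whole orbit is disjoint from
    the image, which is stable under the action, and the disjoint union still embeds in U. *)
Lemma biset_cover (U : biset A G H) (X : set (BAR A R G H)) (l : seq {classic U}) :
  (forall u : U, X (trclass R G H (stab_pair u))) ->
  exists (W : biset A G H) (f : W -> U),
    [/\ equivariant f, injective f, Rspan X (bclass R W) &
        forall u, u \in l -> exists w, f w = u].
Proof.
move=> XU; elim: l => [|u l [W [f [fE fI WX fl]]]].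
  exists (fib0 A (setX_group G H)), (fun w : void => match w with end).
  by split=> [x a []|[]| |u] //; rewrite bclass0; exact: Rspan0.
have [[w fw]|nw] := pselect (exists w, f w = u).
  exists W, f; split=> // v; rewrite inE => /orP[/eqP ->|/fl] //.
  by exists w.
have [g [gE gI gS]] := transitive_embed (u : U).
exists (fib_sum (transitive_set _ (stab_pair (u : U))) W).
exists (fun w => match w with inl c => g c | inr c => f c end).
have gf c d : g c <> f d.
  move=> e; apply: nw.
  have [x Gx [a]] := tbase_transitive c.
  have [b gb] := gS 1%g 1%g (group1 _); rewrite fact1 in gb.
  have [y Gy [a' cE]] := tbase_transitive c.
  have [z Gz [b' bE]] := tbase_transitive b.
  (* Here c = (y, a') and b = (z, b') times the base point, and g b = u, so this element carries f d
     = g c to u. *)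
  exists (fact (z * y^-1)%g (b' * a'^-1)%g d); rewrite fE ?groupM ?groupV //.
  rewrite -e -gE ?groupM ?groupV //; apply: etrans gb; congr g.
  by rewrite cE bE -factM ?groupM ?groupV // !mulgKV.
split=> [x a [c|c]|[c|c] [d|d]||v].
- exact: gE.
- exact: fE.
- by move/gI ->.
- by move/gf.
- by move/esym/gf.
- by move/fI ->.
- rewrite bclass_sum; apply: RspanD => //; apply: Rspan_gen; exact: XU.
rewrite inE => /orP[/eqP ->|/fl[w fw]]; last by exists (inr w).
have [b gb] := gS 1%g 1%g (group1 _); rewrite fact1 in gb.
by exists (inl b).
Qed.

Lemma finite_cover (U : biset A G H) :
  exists l : seq {classic U}, forall v : U,
    exists2 u, u \in l & exists a, v = fact 1%g a u.
Proof.
have [s sE] := (@finite_seqP {classic set U} _).1 (ffin U).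
pose r (c : set U) : option {classic U} :=
  if pselect (exists u, c u) is left e then Some (sval (cid e)) else None.
exists (pmap r s) => v; set c := range (fun a => fact 1%g a v).
have cv : exists u, c u by exists (fact 1%g 1%g v); exists 1%g.
have [u ru [a _ au]] : exists2 u, r c = Some u & c u.
  rewrite /r; case: pselect => // e; exists (sval (cid e)) => //.
  exact: (svalP (cid e)).
exists u; last first.
  by exists a^-1%g; rewrite -au -factMr mulVg fact1.
rewrite mem_pmap -ru; apply/mapP; exists c => //.
have : [set` s] c by rewrite -sE; exists v.
by [].
Qed.

(** Applied to a list that meets every A-orbit, the embedding of [biset_cover] is onto. *)
Lemma bclass_span (U : biset A G H) (X : set (BAR A R G H)) :
  (forall u : U, X (trclass R G H (stab_pair u))) -> Rspan X (bclass R U).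
Proof.
move=> XU; have [l lU] := finite_cover U.
have [W [f [fE fI WX fl]]] := biset_cover l XU.
suff -> : bclass R U = bclass R W by [].
apply/esym/bclass_iso; exists f => //; apply: inj_surj_bij => // v.
have [u /fl[w fw] [a ->]] := lU v.
by exists (fact 1%g a w); rewrite fE ?group1 // fw.
Qed.

End Decomposition.

Lemma mem_setX1l (gT hT : finGroupType) (G : {group gT}) (H : {group hT}) g :
  g \in G -> (g, 1) \in setX_group G H.
Proof. by move=> Gg; rewrite inE /= Gg group1. Qed.

Lemma mem_setX1r (gT hT : finGroupType) (G : {group gT}) (H : {group hT}) h :
  h \in H -> (1, h) \in setX_group G H.
Proof. by move=> Hh; rewrite inE /= Hh group1. Qed.

(** * Tensor products: freeness and stabilizing pairs *)

Section Tensors.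
Variables (A : abGroupType) (gT hT kT : finGroupType).
Variables (G : {group gT}) (H : {group hT}) (K : {group kT}).
Variables (U : biset A G H) (V : biset A H K).

Lemma mem_torbit (u u' : U) (v v' : V) :
  torbit u v (u', v') <->
  exists2 h, h \in H & exists a,
    u' = fact (1, h^-1) a^-1 u /\ v' = fact (h^-1, 1) a v.
Proof.
split=> [[h Hh [a [-> ->]]]|[h Hh [a [-> ->]]]].
  by exists h^-1; [rewrite groupV|exists a; rewrite invgK].
by exists h^-1; [rewrite groupV|exists a].
Qed.

(** If (a u, v) is in the orbit of (u, v), some h scales u by b a and v by b^-1. Compatibility at h
    reads (b a)^-1 = b^-1, hence a = 1. *)
Lemma compat_torbit_free (u : U) (v : V) :
  compat (stab_pair u) (stab_pair v) -> torbit_free u v.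
Proof.
move=> uv a e; have : torbit (fact 1 a u) v (fact 1 a u, v) by exact: torbit_refl.
rewrite e => -[h Hh [b [ub vb]]].
have Gh := mem_setX1r G Hh; have Kh := mem_setX1l K Hh.
have uh : fact (1, h) 1 u = fact 1 (b * a) u.
  by rewrite factMr ub (Defs.factE b^-1 _ Gh) -factMr mulgV fact1.
have vh : fact (h, 1) 1 v = fact 1 b^-1 v.
  by rewrite {2}vb (Defs.factE b _ Kh) -factMr mulVg fact1.
have := uv h; rewrite !inE.
have -> : (1, h) \in mdom (stab_pair u).
  by apply/mem_stabP; split=> //; exists (b * a).
have -> : (h, 1) \in mdom (stab_pair v).
  by apply/mem_stabP; split=> //; exists b^-1.
move=> /(_ isT); rewrite /chi2 /chi1 (stab_chi Gh uh) (stab_chi Kh vh) invMg.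
by rewrite -{2}[b^-1]mul1g => /mulIg /eqP; rewrite invg_eq1 => /eqP.
Qed.

Lemma tens_actE2 (c : tensor U V) u v g k a : sval c = torbit u v ->
  g \in G -> k \in K ->
  sval (fact (g, k) a c) = torbit (fact (g, 1) a u) (fact (1, k) 1 v).
Proof.
move=> cuv Gg Kk; have GKx : (g, k) \in setX_group G K by rewrite inE /= Gg Kk.
by rewrite tens_actE // cuv tens_shift_orbit.
Qed.

(** The element (g, k) scales u (x) v exactly when some h links the two sides: (g, h) scales u and
    (h, k) scales v. The scalars multiply because A moves across the tensor product. *)
Lemma stab_tensor (c : tensor U V) u v : sval c = torbit u v ->
  compat (stab_pair u) (stab_pair v) ->
  stab_pair c = mstar (stab_pair u) (stab_pair v).
Proof.
move=> cuv uv; apply: stab_uniq => [[g k] /mem_mstar[h [ugh vhk]]|[g k] a].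
  have := fintype.subsetP (stab_sub u) _ ugh; rewrite inE /= => /andP[Gg Hh].
  have := fintype.subsetP (stab_sub v) _ vhk; rewrite inE /= => /andP[_ Kk].
  split; first by rewrite inE /= Gg Kk.
  apply: tens_car_inj; rewrite (tens_actE2 _ cuv) // (mstarE uv ugh vhk).
  rewrite [RHS](tens_actE2 _ cuv) ?group1 // fact1.
  set a := mchi _ (g, h); set b := mchi _ (h, k).
  apply: torbit_eq; apply/mem_torbit; exists h => //; exists b.
  have Gh : (1, h^-1) \in setX_group G H by rewrite mem_setX1r ?groupV.
  have Kh : (h^-1, 1) \in setX_group H K by rewrite mem_setX1l ?groupV.
  have GHgh : (g, h) \in setX_group G H by rewrite inE /= Gg Hh.
  have HKhk : (h, k) \in setX_group H K by rewrite inE /= Hh Kk.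
  split.
    have -> : fact (g, 1) 1 u = fact (1, h^-1) 1 (fact (g, h) 1 u).
      by rewrite -factM // pairM mul1g mulVg mulg1.
    rewrite (stabE ugh) -factM ?group1 // -factM ?group1 // mul1g !mulg1.
    by rewrite (abmulgC a) mulKg.
  have -> : fact (1, k) 1 v = fact (h^-1, 1) 1 (fact (h, k) 1 v).
    by rewrite -factM // pairM mul1g mulVg mulg1.
  by rewrite (stabE vhk) -factM ?group1 // mul1g mulg1.
move=> GKx; have := GKx; rewrite inE /= => /andP[Gg Kk].
move=> /(congr1 sval); rewrite (tens_actE2 _ cuv) //.
rewrite [RHS](tens_actE2 _ cuv) ?group1 // fact1 => e.
have : torbit (fact 1 a u) v (fact (g, 1) 1 u, fact (1, k) 1 v).
  by rewrite -e; exact: torbit_refl.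
move=> /mem_torbit[h Hh [b [ub vb]]]; apply/mem_mstar; exists h.
have GHgh : (g, h) \in setX_group G H by rewrite inE /= Gg Hh.
have HKhk : (h, k) \in setX_group H K by rewrite inE /= Hh Kk.
have Gg1 := mem_setX1l H Gg; have Kk1 := mem_setX1r H Kk.
have Gh := mem_setX1r G Hh; have Kh := mem_setX1l K Hh.
split; apply/mem_stabP; split=> //.
  exists (b^-1 * a).
  have -> : (g, h) = (1, h) * (g, 1) by rewrite pairM mul1g mulg1.
  rewrite factMl // ub -factM ?mem_setX1r ?groupV //.
  by rewrite pairM mulg1 mulgV mul1g -factMr.
exists b.
have -> : (h, k) = (h, 1) * (1, k) by rewrite pairM mul1g mulg1.
rewrite factMl // vb -factM ?mem_setX1l ?groupV //.
by rewrite pairM mulg1 mulgV mul1g.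
Qed.

Definition tpoint (u : U) (v : V) (uv : torbit_free u v) : tensor U V :=
  exist _ (torbit u v) (ex_intro _ u (ex_intro _ v (conj erefl uv))).

End Tensors.

(** * Composition of transitive classes *)

Section Mackey.
Variables (A : abGroupType) (R : comPzRingType) (gT hT kT : finGroupType).
Variables (G : {group gT}) (H : {group hT}) (K : {group kT}).
Variables (p : mpair A (gT * hT)%type) (q : mpair A (hT * kT)%type).

(* As p_2(p) = H, there is only one double coset p_2(p) \ H / p_1(q) in the
   Mackey formula. *)
Lemma trclass_comp :
  mdom p \subset setX_group G H -> mdom q \subset setX_group H K ->
  (forall h, h \in H -> exists g, (g, h) \in mdom p) -> compat p q ->
  bcomp (trclass R G H p) (trclass R H K q) = trclass R G K (mstar p q).
Proof.
move=> pG qH pH pq; rewrite /trclass bcomp_class; apply/esym/bclass_iso.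
have uv : compat (stab_pair (tbase (setX_group G H) p))
                 (stab_pair (tbase (setX_group H K) q)) by rewrite !stab_tbase.
set u := tbase (setX_group G H) p in uv; set v := tbase (setX_group H K) q in uv.
pose c := tpoint (compat_torbit_free uv).
have <- : stab_pair c = mstar p q.
  by rewrite (stab_tensor (u := u) (v := v)) // !stab_tbase.
apply: transitive_iso => d.
have [u' [v' [duv _]]] := svalP d.
have [[g h] /setXP[Gg Hh] [a u'E]] := tbase_transitive u'.
have [[h' k] /setXP[Hh' Kk] [b v'E]] := tbase_transitive v'.
(* Since (g0, h^-1 h') scales u, the factor (g, h) u is a multiple of (g g0, h') u. The two
   occurrences of h' then cancel across the tensor product, and d becomes a multiple of c. *)
have [g0 pg0] : exists g0, (g0, h^-1 * h') \in mdom p.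
  by apply: pH; rewrite groupM ?groupV.
have GH0 := fintype.subsetP pG _ pg0.
have Gg0 : g0 \in G by move: GH0; rewrite inE => /andP[].
have u0 : fact (g0, h^-1 * h') 1 u = fact 1 (mchi p (g0, h^-1 * h')) u.
  by rewrite stabE ?stab_tbase.
set e := mchi p _ in u0.
have uE : u = fact (g0, h^-1 * h') e^-1 u.
  by rewrite Defs.factE // u0 -factMr mulVg fact1.
exists (g * g0, k); first by rewrite inE /= groupM.
exists (a * e^-1 * b); apply: tens_car_inj.
rewrite (tens_actE2 (u := u) (v := v)) ?groupM // duv; apply/esym/torbit_eq.
apply/mem_torbit; exists h' => //; exists b^-1; rewrite u'E v'E.
split.
  rewrite -/u {2}uE -!factM ?inE /= ?groupM ?groupV ?Gg ?Hh ?Hh' ?Gg0 ?group1 //.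
  rewrite !pairM /= -(mulgA h'^-1) mulKVg mulVg invgK -(mulgA b).
  by rewrite mul1g (abmulgC b).
rewrite -factM ?inE /= ?groupV ?Hh' ?Kk ?group1 //.
by rewrite pairM mulVg mul1g mulVg.
Qed.
End Mackey.

(** * Sums with finite support and their reindexing *)

Section FiniteSums.
Local Open Scope ring_scope.

(** Reindexing along a relation rather than a function, since representatives correspond to each
    other only up to their orbits. *)
Lemma fsbig_match (M : zmodType) (I J : choiceType) (X : set I) (Y : set J)
    (r : I -> J -> Prop) (F : I -> M) (F' : J -> M) :
  (forall i, X i -> exists2 j, Y j & r i j) ->
  (forall j, Y j -> exists2 i, X i & r i j) ->
  (forall i j j', X i -> Y j -> Y j' -> r i j -> r i j' -> j = j') ->
  (forall i i' j, X i -> X i' -> Y j -> r i j -> r i' j -> i = i') ->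
  (forall i j, X i -> Y j -> r i j -> F i = F' j) ->
  \sum_(i \in X) F i = \sum_(j \in Y) F' j.
Proof.
(* The empty case is treated apart because the reindexing function needs a default value [j0] in
   Y. *)
move=> XY YX rfun rinj FF'; have [X0|/set0P[i0 Xi0]] := eqVneq X set0.
  have -> : Y = set0.
    by apply/seteqP; split=> // j /YX[i]; rewrite X0.
  by rewrite X0 !fsbig_set0.
have [j0 Yj0 _] := XY i0 Xi0.
pose h i := if pselect (exists2 j, Y j & r i j) is left e
  then sval (cid2 e) else j0.
have hP i : X i -> Y (h i) /\ r i (h i).
  move=> /XY e; rewrite /h; case: pselect => // e'.
  by case: (cid2 e') => j Yj rij.
rewrite (@reindex_fsbig _ _ _ _ _ h X Y).
  apply: eq_fsbigr => i /set_mem Xi; have [Yh rh] := hP i Xi; exact: FF'.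
split=> [i Xi|i i' /set_mem Xi /set_mem Xi' e|j Yj].
- by have [] := hP i Xi.
- have [Yh rh] := hP i Xi; have [Yh' rh'] := hP i' Xi'.
  by apply: (rinj _ _ (h i)) => //; rewrite e.
- have [i Xi rij] := YX j Yj; exists i => //; have [Yh rh] := hP i Xi.
  exact: rfun rh rij.
Qed.

Lemma fsbig_morph (M N : zmodType) (f : M -> N) (I : choiceType) (X : set I)
    (F : I -> M) :
  finite_set X -> f 0 = 0 -> {morph f : x y / x + y} ->
  f (\sum_(i \in X) F i) = \sum_(i \in X) f (F i).
Proof. by move=> fX f0 fD; rewrite !fsbig_finite // (big_morph f fD f0). Qed.

Lemma finite_functional (I J : Type) (B : set I) (r : I -> J -> Prop) :
  finite_set B -> (forall i j j', B i -> r i j -> r i j' -> j = j') ->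
  finite_set [set j | exists2 i, B i & r i j].
Proof.
move=> fB rfun.
pose h i : option J := if pselect (exists j, r i j) is left e
  then Some (sval (cid e)) else None.
apply: (@sub_finite_set _ _ (Some @^-1` (h @` B))).
  move=> j [i Bi rij]; exists i => //; rewrite /h; case: pselect => [e|[]].
    by congr Some; case: (cid e) => j' rij' /=; exact: rfun rij' rij.
  by exists j.
apply: finite_preimage; last exact: finite_image.
by move=> j j' _ _ [].
Qed.

End FiniteSums.

(** * The (A, H)-orbits of a biset and sums over them *)

Section Orbits.
Variables (A : abGroupType) (gT hT : finGroupType).
Variables (G : {group gT}) (H : {group hT}).
Implicit Types U V : biset A G H.

Definition orb U (u v : U) : Prop :=
  exists2 h, h \in H & exists a, v = fact (1, h) a u.

Lemma orb_refl U (u : U) : orb u u.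
Proof. by exists 1 => //; exists 1; rewrite fact1. Qed.

Lemma orb_sym U (u v : U) : orb u v -> orb v u.
Proof.
move=> [h Hh [a ->]]; exists h^-1; rewrite ?groupV //; exists a^-1.
by rewrite -factM ?mem_setX1r ?groupV // pairM mul1g !mulVg fact1.
Qed.

Lemma orb_trans U (u v w : U) : orb u v -> orb v w -> orb u w.
Proof.
move=> [h Hh [a ->]] [l Hl [b ->]]; exists (l * h); rewrite ?groupM //.
by exists (b * a); rewrite -factM ?mem_setX1r // pairM mul1g.
Qed.

Definition orb_reps U (X : set U) : Prop :=
  (forall v, exists2 u, X u & orb u v) /\
  (forall u u', X u -> X u' -> orb u u' -> u = u').

Lemma orb_reps_exists U : exists X : set U, orb_reps X.
Proof.
have ne (u : U) : exists v, orb u v := ex_intro _ u (orb_refl u).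
pose r (u : U) := sval (cid (ne u)).
have rP u : orb u (r u) by exact: (svalP (cid (ne u))).
have rE u v : orb u v -> r u = r v.
  (* Equal predicates with irrelevant proofs of non-emptiness make the choice operator return the
     same element, so r is constant on orbits. *)
  move=> uv; have e : orb u = orb v.
    apply/predeqP => w; split; apply: orb_trans => //; exact: orb_sym.
  rewrite /r; move: (ne u) (ne v); rewrite e => e1 e2.
  by rewrite (Prop_irrelevance e1 e2).
exists (range r); split=> [v|_ _ [u _ <-] [v _ <-] uv].
  by exists (r v); [exists v|apply/orb_sym/rP].
by apply: rE; apply: orb_trans (rP u) _; apply: orb_trans uv (orb_sym (rP v)).
Qed.

(** A fixed system of representatives makes F^+([U]) a function of U alone; the passage to any other
    system is [orbit_sum_indep]. *)
Definition reps U : set U := sval (cid (@orb_reps_exists U)).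

Lemma repsP U : orb_reps (@reps U).
Proof. exact: (svalP (cid (@orb_reps_exists U))). Qed.

(** There are finitely many A-orbits, and two representatives in the same A-orbit are equal. *)
Lemma finite_reps U (X : set U) : orb_reps X -> finite_set X.
Proof.
move=> [_ XI].
have := finite_functional (r := fun c u => X u /\ c = range (fun a => fact 1 a u))
  (ffin U).
move=> fX; apply: sub_finite_set (fX _).
  by move=> u Xu; exists (range (fun a => fact 1 a u)); first by exists u.
move=> c u v _ [Xu ->] [Xv /seteqP[uv _]]; apply: XI => //.
have [a _ va] := uv u (ex_intro2 _ _ 1 I (fact1 u)).
by apply: orb_sym; exists 1 => //; exists a.
Qed.

Local Open Scope ring_scope.

Lemma orbit_sum_map (M : zmodType) U V (X : set U) (Y : set V) (f : U -> V)
    (F : {classic U} -> M) (F' : {classic V} -> M) :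
  orb_reps X -> orb_reps Y ->
  (forall u u', orb u u' <-> orb (f u) (f u')) ->
  (forall v, exists u, orb (f u) v) ->
  (forall v v', orb v v' -> F' v = F' v') -> (forall u, F u = F' (f u)) ->
  \sum_(u \in (X : set {classic U})) F u =
  \sum_(v \in (Y : set {classic V})) F' v.
Proof.
move=> [X1 X2] [Y1 Y2] fI fS F'I FF'.
apply: (@fsbig_match M {classic U} {classic V} X Y
    (fun u v => orb (f u) v) F F') => [u Xu|v Yv|u v v'|u u' v|u v].
- by have [v Yv vu] := Y1 (f u); exists v => //; exact: orb_sym.
- have [u uv] := fS v; have [u' Xu' u'u] := X1 u.
  by exists u' => //; apply: orb_trans uv; apply/fI.
- by move=> _ Yv Yv' uv uv'; apply: Y2 => //; apply: orb_trans (orb_sym uv) uv'.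
- move=> Xu Xu' _ uv u'v; apply: X2 => //; apply/fI.
  exact: orb_trans uv (orb_sym u'v).
- by move=> _ _ uv; rewrite FF'; exact: F'I.
Qed.

Lemma orbit_sum_indep (M : zmodType) U (X Y : set U) (F : {classic U} -> M) :
  orb_reps X -> orb_reps Y -> (forall u v, orb u v -> F u = F v) ->
  \sum_(u \in (X : set {classic U})) F u =
  \sum_(u \in (Y : set {classic U})) F u.
Proof.
move=> rX rY FI; apply: (orbit_sum_map (f := id)) => // v.
by exists v; exact: orb_refl.
Qed.

Lemma orb_equivariant U V (f : U -> V) u u' :
  equivariant f -> injective f -> orb u u' <-> orb (f u) (f u').
Proof.
move=> fE fI; split=> -[h Hh [a e]]; exists h => //; exists a.
  by rewrite e fE ?mem_setX1r.
by apply: fI; rewrite fE ?mem_setX1r.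
Qed.

End Orbits.

Arguments reps {A gT hT G H} U.
Arguments repsP {A gT hT G H} U.

Lemma finite_reps_classic (A : abGroupType) (gT hT : finGroupType)
    (G : {group gT}) (H : {group hT}) (U : biset A G H) :
  finite_set (reps U : set {classic U}).
Proof. exact: finite_reps (repsP U). Qed.

Lemma orbit_reps_orb (A : abGroupType) (C : group_class) (G H : gobj C)
    (U : biset A G H) (X : set U) : orbit_reps X -> orb_reps X.
Proof.
move=> rX; split=> [v|u u' Xu Xu' uu'].
  by have [u [[Xu uv] _]] := rX v; exists u.
have [w [_ wU]] := rX u'; rewrite -(wU u) ?(wU u') //; split=> //.
exact: orb_refl.
Qed.


(** * The summands of F^+ and their behaviour under composition and conjugation *)

Section Terms.
Variables (A : abGroupType) (R : comPzRingType) (C : group_class).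
Variable S : pair_family A.
Hypotheses (S_wf : family_wf C S) (S_i : axiom_i C S) (S_ii : axiom_ii C S).
Hypotheses (S_iii : axiom_iii C S) (S_vii : axiom_vii C S).
Hypothesis S_viii : axiom_viii C S.
Hypothesis S_k2 : forall (gT hT : finGroupType) (G : {group gT})
  (H : {group hT}) (p : mpair A (gT * hT)%type),
  C G -> C H -> S G H p -> ker2 (mdom p) = [set 1%g]%SET.
Local Open Scope ring_scope.

Lemma mrestr_id (gT hT : finGroupType) (K : {group gT})
    (s : mpair A (gT * hT)%type) : mrestr K (mrestr K s) = mrestr K s.
Proof.
apply: mpair_ext => x; rewrite !mem_mrestr; first by rewrite -andbA andbb.
by move=> /andP[_ Kx]; rewrite mrestr_chi.
Qed.

Lemma mprime_inj (G : gobj C) (i j : mprime A G) :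
  mppair i = mppair j -> i = j.
Proof.
case: i j => i i1 i2 [j j1 j2] /= e; case: j / e j1 j2 => j1 j2.
by rewrite (Prop_irrelevance i1 j1) (Prop_irrelevance i2 j2).
Qed.

Lemma homs_trclass (G H : gobj C) p :
  S G H p -> homs R S G H (trclass R G H p).
Proof. by move=> Sp; apply: Rspan_gen; exists p. Qed.

Lemma fextE (D : homfam A R C) (F : functor D) (G H : gobj C)
    (f : fhom D G H) x : fext F (sval f) x = fmap F f x.
Proof.
rewrite /fext; case: pselect => [Df|[]]; last exact: (svalP f).
by congr (fmap F _ x); case: f Df => f Df Df'; congr exist.
Qed.

Lemma fext_comp (D : homfam A R C) (F : functor D) (G H K : gobj C) f g x :
  D G H f -> D H K g -> D G K (bcomp f g) ->
  fext F (bcomp f g) x = fext F f (fext F g x).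
Proof.
move=> Df Dg Dfg; rewrite -[f]/(sval (exist _ f Df)) -[g]/(sval (exist _ g Dg)).
rewrite (fextE (F := F) (exist _ _ Dg)) (fextE (F := F) (exist _ _ Df)).
rewrite -[bcomp _ _]/(sval (exist _ _ Dfg)) (fextE (F := F) (exist _ _ Dfg)).
exact: (fmor_comp (fstr F)).
Qed.

(* The second condition holds automatically when s is in S^+. It is needed for
   the stabilizing pairs of U (x) V, which may lie outside S^+ when the class of
   groups is not closed under intersections. *)
Definition good (G H : gobj C) (s : mpair A (gtype G * gtype H)%type)
    (i : mprime A G) (j : mprime A H) : Prop :=
  transports s i j /\ S (mdom i) (mdom j) (mrestr (mdom i) s).

Section Functor.
Variable F : functor (homs R S : homfam A R C).

Definition rmap (G H : gobj C) (s : mpair A (gtype G * gtype H)%type)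
    (i : mprime A G) (j : mprime A H) (y : F (mpobj j)) : F (mpobj i) :=
  fext F (trclass R (mpobj i) (mpobj j) (mrestr (mdom i) s)) y.

(** Stated for a bare pair instead of an element u, so that composites and conjugates of pairs can
    be substituted for s. It is 0 when nothing contributes. *)
Definition term (G H : gobj C) (s : mpair A (gtype G * gtype H)%type)
    (i : mprime A G) (x : plus_mod F H) : F (mpobj i) :=
  if pselect (exists j, good s i j) is left e
  then rmap s i (x (sval (cid e))) else 0.

Lemma good_uniq (G H : gobj C) (s : mpair A (gtype G * gtype H)%type)
    (i : mprime A G) (j j' : mprime A H) : good s i j -> good s i j' -> j = j'.
Proof. by move=> [sj _] [sj' _]; apply: mprime_inj; apply: transports_uniq sj sj'. Qed.

Lemma termE (G H : gobj C) (s : mpair A (gtype G * gtype H)%type)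
    (i : mprime A G) (j : mprime A H) (x : plus_mod F H) :
  good s i j -> term s i x = rmap s i (x j).
Proof.
move=> sij; rewrite /term; case: pselect => [e|[]]; last by exists j.
by case: (cid e) => j' sij' /=; rewrite (good_uniq sij' sij).
Qed.

Lemma term0 (G H : gobj C) (s : mpair A (gtype G * gtype H)%type)
    (i : mprime A G) (x : plus_mod F H) :
  (forall j, ~ good s i j) -> term s i x = 0.
Proof. by move=> n; rewrite /term; case: pselect => // -[j sij]; case: (n j). Qed.

Lemma good_mrestr (G H : gobj C) (s s' : mpair A (gtype G * gtype H)%type)
    (i : mprime A G) (j : mprime A H) :
  mrestr (mdom i) s = mrestr (mdom i) s' -> good s i j -> good s' i j.
Proof. by move=> e [sij Ss]; split; [exact: transports_mrestr sij|rewrite -e]. Qed.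

(** Once restricted to [mdom i], s projects onto all of [mdom j], which is the situation of
    [trclass_comp]; axiom (iii) keeps the composite in S. *)
Lemma good_mstar (G H K : gobj C) (s : mpair A (gtype G * gtype H)%type)
    (t : mpair A (gtype H * gtype K)%type) (i : mprime A G) (j : mprime A H)
    (k : mprime A K) :
  good s i j -> good t j k ->
  good (mstar s t) i k /\
  forall y : F (mpobj k), rmap (mstar s t) i y = rmap s i (rmap t j y).
Proof.
move=> [sij Ss] [tjk St]; have e := mrestr_mstar sij tjk.
have rij := transports_mrestr (esym (mrestr_id (mdom i) s)) sij.
have rjk := transports_mrestr (esym (mrestr_id (mdom j) t)) tjk.
have rc := transports_compat rij rjk.
have Sst : S (mdom i) (mdom k) (mrestr (mdom i) (mstar s t)).
  by rewrite -e; apply: (@S_iii _ _ _ _ (mdom j)) => //; exact: mpC.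
split; first by split=> //; exact: transports_mstar tjk.
move=> y; rewrite /rmap -fext_comp.
- rewrite (trclass_comp R (G := mpobj i) (H := mpobj j) (K := mpobj k)) ?e //.
  + by apply: S_wf => //; exact: mpC.
  + by apply: S_wf => //; exact: mpC.
  + by case: rij => _ r2 _ _ h /r2[g _ sgh]; exists g.
- exact: homs_trclass.
- exact: homs_trclass.
- rewrite (trclass_comp R (G := mpobj i) (H := mpobj j) (K := mpobj k)) ?e //.
  + exact: homs_trclass.
  + by apply: S_wf => //; exact: mpC.
  + by apply: S_wf => //; exact: mpC.
  + by case: rij => _ r2 _ _ h /r2[g _ sgh]; exists g.
Qed.

(** Axioms (i) and (ii) put the conjugate of the diagonal of G by (g, 1) in S. Cutting it down to K
    on the right by axiom (vii) leaves the graph, and the same axiom puts the conjugate of K in the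
    class. *)
Lemma S_cpair (gT : finGroupType) (G K L : {group gT}) g :
  C G -> C K -> K \subset G -> g \in G -> L = (K :^ g^-1)%g%G ->
  C L /\ S L K (cpair A g K).
Proof.
move=> CG CK /fintype.subsetP KG Gg LE.
pose p := mconj2 g 1%g (mtriv A (diag_group G)).
have Sp : S G G p by apply: S_ii => //; [rewrite inE /= Gg group1|exact: S_i].
have pP a b : ((a, b) \in mdom p) = (b \in G) && (a == b ^ g^-1)%g.
  rewrite mem_mconj2 /= conjg1; apply/diagP/andP => /= [[Ga ->]|[Gb /eqP ->]].
    by rewrite Ga conjgK.
  by rewrite conjgKV.
have Kp : K \subset dproj2 (mdom p).
  apply/fintype.subsetP => k /KG Gk; apply/dproj2P; exists (k ^ g^-1)%g.
  by rewrite pP Gk eqxx.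
have [_ /(_ K Kp CK)[]] := S_vii CG CG Sp.
have -> : lstar_group (mdom p) K = L.
  apply/val_inj/setP => x; rewrite LE mem_conjg invgK.
  apply/lstarP/idP => [[k Kk]|Kx].
    by rewrite pP => /andP[_ /eqP ->]; rewrite conjgKV.
  by exists (x ^ g)%g => //; rewrite pP KG //= conjgK.
have -> : mstar p (mtriv A (diag_group K)) = cpair A g K.
  apply: mstar_uniq => [x _|a b c|a b].
  - by rewrite /chi2 /chi1 /p mconj2_chi !mtriv_chi invg1.
  - rewrite pP => /andP[_ /eqP ->] /diagP[/= Kb ->].
    rewrite (mem_cpair A) eqxx andbT; split; first exact: Kb.
    by rewrite mconj2_chi !mtriv_chi mulg1.
  - rewrite (mem_cpair A) => /andP[Kb ab]; exists b; rewrite pP KG // ab.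
    by split=> //; apply/diagP.
by [].
Qed.

Lemma good_cpair (G : gobj C) (g : gtype G) (i i' : mprime A G) :
  g \in G -> mppair i' = mconj g i -> good (cpair A g (mdom i)) i' i.
Proof.
move=> Gg i'i; split; first by rewrite i'i; exact: transports_cpair.
have i'E : mdom i' = (mdom i :^ g^-1)%g%G by rewrite i'i mkpair_dom.
rewrite mrestr_cpair; last by rewrite i'E.
by have [] := S_cpair (gobjP G) (mpC i) (mpsub i) Gg i'E.
Qed.

Lemma rmap_cpair (G : gobj C) (g : gtype G) (i i' : mprime A G)
    (x : plus_mod F G) : g \in G -> mppair i' = mconj g i ->
  rmap (cpair A g (mdom i)) i' (x i) = x i'.
Proof.
move=> Gg i'i; rewrite (plus_equivP x Gg i'i) /rmap mrestr_cpair //.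
by rewrite i'i mkpair_dom.
Qed.

Lemma mconj_mprime (G : gobj C) (g : gtype G) (i : mprime A G) :
  g \in G -> exists i' : mprime A G, mppair i' = mconj g i.
Proof.
move=> Gg; have CL : C (mdom (mconj g i)).
  have [] := S_cpair (gobjP G) (mpC i) (mpsub i) Gg (L := mdom (mconj g i)) => //.
  by rewrite mkpair_dom.
have sL : mdom (mconj g i) \subset G.
  apply/fintype.subsetP => x; rewrite mem_mconj => /(fintype.subsetP (mpsub i)).
  by rewrite groupJr.
by exists (MPrime sL CL).
Qed.

Lemma mconj2K (gT hT : finGroupType) (g : gT) (h : hT)
    (s : mpair A (gT * hT)%type) : mconj2 g^-1%g h^-1%g (mconj2 g h s) = s.
Proof.
rewrite /mconj2 -mconjM.
have -> : ((g^-1, h^-1) * (g, h) = 1)%g by rewrite pairM !mulVg.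
exact: mconj1.
Qed.

Lemma good_mconjl (G H : gobj C) (s : mpair A (gtype G * gtype H)%type)
    (g : gtype G) (i i' : mprime A G) (j : mprime A H) :
  g \in G -> mppair i' = mconj g i -> good s i j ->
  good (mconj2 g 1%g s) i' j /\ forall y : F (mpobj j),
    rmap (mconj2 g 1%g s) i' y = rmap (cpair A g (mdom i)) i' (rmap s i y).
Proof.
move=> Gg i'i sij; have [w wE] := good_mstar (good_cpair Gg i'i) sij.
have e := mrestr_mconjl g i s; rewrite -i'i in e.
by split; [exact: good_mrestr w|move=> y; rewrite -wE /rmap e].
Qed.

Lemma term_mconjl (G H : gobj C) (s : mpair A (gtype G * gtype H)%type)
    (g : gtype G) (i i' : mprime A G) (x : plus_mod F H) :
  g \in G -> mppair i' = mconj g i ->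
  term (mconj2 g 1%g s) i' x = rmap (cpair A g (mdom i)) i' (term s i x).
Proof.
move=> Gg i'i; have [[j sij]|n] := pselect (exists j, good s i j).
  have [s'ij e] := good_mconjl Gg i'i sij.
  by rewrite (termE _ s'ij) e (termE _ sij).
rewrite (term0 (s := s)); last by move=> j sij; apply: n; exists j.
rewrite term0 /rmap ?fext0 // => j s'ij; apply: n; exists j.
have Gg' : (g^-1)%g \in G by rewrite groupV.
have ii' : mppair i = mconj g^-1%g i' by rewrite i'i -mconjM mulVg mconj1.
have [+ _] := good_mconjl Gg' ii' s'ij.
by rewrite -{1}[1%g]invg1 mconj2K.
Qed.

(** Conjugating s on the right by h moves the contributing index j to its conjugate, and the
    equivariance of the family x under H compensates for it. *)
Lemma term_mconjr (G H : gobj C) (s : mpair A (gtype G * gtype H)%type)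
    (h : gtype H) (i : mprime A G) (x : plus_mod F H) :
  h \in H -> term (mconj2 1%g h s) i x = term s i x.
Proof.
have aux (l : gtype H) (t : mpair A (gtype G * gtype H)%type) j :
    l \in H -> good t i j -> exists2 j',
    good (mconj2 1%g l t) i j' & rmap (mconj2 1%g l t) i (x j') = rmap t i (x j).
  move=> Hl tij; have [j' j'j] := mconj_mprime j Hl.
  have jj' : mppair j = mconj l^-1 j' by rewrite j'j -mconjM mulVg mconj1.
  have Hl' : (l^-1)%g \in H by rewrite groupV.
  have [w wE] := good_mstar tij (good_cpair Hl' jj').
  have e := mrestr_mconjr l tij.1; rewrite -j'j in e.
  exists j'; first exact: good_mrestr w.
  by rewrite -(rmap_cpair x Hl' jj') -wE /rmap e.
move=> Hh; have [[j sij]|n] := pselect (exists j, good s i j).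
  have [j' s'ij' e] := aux h s j Hh sij.
  by rewrite (termE _ sij) (termE _ s'ij').
rewrite !term0 // => [j sij|j s'ij]; first by apply: n; exists j.
have Hh' : (h^-1)%g \in H by rewrite groupV.
have [j' + _] := aux _ _ _ Hh' s'ij; rewrite -{1}[1%g]invg1 mconj2K => sij'.
by apply: n; exists j'.
Qed.

(** Axiom (viii) is applied to s between its own projections: composing with the diagonal of
    [mdom i] on the left is the restriction, and the domain of j is found to be in the class. *)
Lemma splus_good (G H : gobj C) (s : mpair A (gtype G * gtype H)%type)
    (i : mprime A G) (j : mpair A (gtype H)) :
  splus C S G H s -> transports s i j ->
  exists2 j' : mprime A H, mppair j' = j & good s i j'.
Proof.
move=> [/fintype.subsetP sGH C1 C2 Ss] sij.
have [i1 jE _ _] := (transportsP s i j).2 sij.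
have [_ /(_ (mdom i) i1 (mpC i))[Cj]] := S_viii C1 C2 Ss.
have -> : mstar (mtriv A (diag_group (mdom i))) s = mrestr (mdom i) s.
  apply: mstar_uniq => [h|g h k|g h].
  - rewrite !inE => /andP[/diagP[/= _ ->] _].
    by rewrite /chi2 /chi1 !mchi1 invg1.
  - move=> /diagP[/= ig ->] shk; rewrite mem_mrestr shk ig.
    by rewrite mrestr_chi // mtriv_chi mul1g.
  - rewrite mem_mrestr => /andP[sgh /= ig]; exists g; split=> //.
    by apply/diagP.
rewrite -jE in Cj * => Sr.
have jH : mdom j \subset H.
  apply/fintype.subsetP => h; case: sij => _ i2 _ _ /i2[g _ /sGH].
  by rewrite inE => /andP[].
by exists (MPrime jH Cj).
Qed.

(** When t contributes nothing at j, neither does the composite: [transports_split] would produce a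
    transport of t from j, which is good because t is in S^+. *)
Lemma term_mstar (G H K : gobj C) (s : mpair A (gtype G * gtype H)%type)
    (t : mpair A (gtype H * gtype K)%type) (i : mprime A G) (j : mprime A H)
    (x : plus_mod F K) :
  splus C S H K t -> ker2 (mdom s) = [set 1%g]%SET -> good s i j ->
  term (mstar s t) i x = rmap s i (term t j x).
Proof.
move=> St s1 sij; have [[k tjk]|n] := pselect (exists k, good t j k).
  have [stik e] := good_mstar sij tjk.
  by rewrite (termE _ stik) e (termE _ tjk).
rewrite (term0 (s := t)); last by move=> k tjk; apply: n; exists k.
rewrite term0 => [|k [stik _]]; first by rewrite /rmap fext0.
have [j' sij' tj'k] := transports_split s1 stik.
rewrite (transports_uniq sij' sij.1) in tj'k.
by have [k' _ tjk'] := splus_good St tj'k; apply: n; exists k'.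
Qed.

Lemma term_mstar0 (G H K : gobj C) (s : mpair A (gtype G * gtype H)%type)
    (t : mpair A (gtype H * gtype K)%type) (i : mprime A G)
    (x : plus_mod F K) :
  splus C S G H s -> ker2 (mdom s) = [set 1%g]%SET ->
  (forall j, ~ good s i j) -> term (mstar s t) i x = 0.
Proof.
move=> Ss s1 n; apply: term0 => k [stik _].
have [j sij _] := transports_split s1 stik.
by have [j' _ sij'] := splus_good Ss sij; exact: n sij'.
Qed.

(* Axiom (ii) only covers conjugation inside p_1(s) x p_2(s); for the rest, the
   conjugate is written as a composite with two conjugation graphs. *)
Lemma splus_mconj2 (G H : gobj C) (s : mpair A (gtype G * gtype H)%type) g h :
  g \in G -> h \in H -> splus C S G H s -> splus C S G H (mconj2 g h s).
Proof.
move=> Gg Hh [/fintype.subsetP sGH C1 C2 Ss].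
pose P1 := dproj1 (mdom s); pose P2 := dproj2 (mdom s).
pose L1 : {group gtype G} := (P1 :^ g^-1)%G.
pose L2 : {group gtype H} := (P2 :^ h^-1)%G.
have s1 a b : (a, b) \in mdom s -> a \in P1 by move=> sab; apply/dproj1P; exists b.
have s2 a b : (a, b) \in mdom s -> b \in P2 by move=> sab; apply/dproj2P; exists a.
have P1G : P1 \subset G.
  by apply/fintype.subsetP => a /dproj1P[b /sGH]; rewrite inE => /andP[].
have P2H : P2 \subset H.
  by apply/fintype.subsetP => b /dproj2P[a /sGH]; rewrite inE => /andP[].
have [CL1 SL1] := S_cpair (gobjP G) C1 P1G Gg (erefl L1).
have [CL2 _] := S_cpair (gobjP H) C2 P2H Hh (erefl L2).
have L2H : L2 \subset H by rewrite conj_subG // groupV.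
have Hh' : (h^-1)%g \in H by rewrite groupV.
(* Conjugating back by h^-1 yields a graph with [P2] on the left, the side on which it is composed
   with s. *)
have P2E : P2 = (L2 :^ h^-1^-1)%g%G.
  by apply/val_inj; rewrite /= invgK conjsgKV.
have [_ SL2] := S_cpair (gobjP H) CL2 L2H Hh' P2E.
have scE : mstar s (cpair A h^-1 L2) = mconj2 1%g h s.
  apply: mstar_uniq => [|a c b sac|a b]; first exact: compat_cpairr.
    rewrite (mem_cpair A) invgK => /andP[_ /eqP cb].
    by rewrite mem_mconj2 mconj2_chi /= conjg1 -cb mtriv_chi mulg1.
  rewrite mem_mconj2 /= conjg1 => sab; exists (b ^ h)%g; split=> //.
  by rewrite (mem_cpair A) mem_conjg !invgK (s2 a) ?eqxx.
have csE : mstar (cpair A g P1) (mconj2 1%g h s) = mconj2 g h s.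
  apply: mstar_uniq => [|a c b|a b]; first exact: compat_cpairl.
    rewrite (mem_cpair A) => /andP[_ /eqP ->]; rewrite !mem_mconj2 !mconj2_chi /=.
    by rewrite conjg1 conjgKV mtriv_chi mul1g.
  rewrite mem_mconj2 /= => sab; exists (a ^ g)%g.
  by rewrite (mem_cpair A) mem_mconj2 /= conjg1 conjgK (s1 _ _ sab) eqxx.
have d1 : dproj1 (mdom (mconj2 g h s)) = L1.
  apply/val_inj/setP => a /=; rewrite mem_conjg invgK; apply/dproj1P/dproj1P.
    by move=> [b]; rewrite mem_mconj2; exists (b ^ h)%g.
  by move=> [b sab]; exists (b ^ h^-1)%g; rewrite mem_mconj2 /= conjgKV.
have d2 : dproj2 (mdom (mconj2 g h s)) = L2.
  apply/val_inj/setP => b /=; rewrite mem_conjg invgK; apply/dproj2P/dproj2P.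
    by move=> [a]; rewrite mem_mconj2; exists (a ^ g)%g.
  by move=> [a sab]; exists (a ^ g^-1)%g; rewrite mem_mconj2 /= conjgKV.
split; rewrite ?d1 ?d2 //.
  apply/fintype.subsetP => -[a b]; rewrite mem_mconj2 => /sGH.
  by rewrite !inE /= !groupJr.
rewrite -csE -scE; apply: (@S_iii _ _ _ _ P1) => //; last exact: compat_cpairl.
by apply: (@S_iii _ _ _ _ P2) => //; exact: compat_cpairr.
Qed.

Lemma rmap0 (G H : gobj C) (s : mpair A (gtype G * gtype H)%type)
    (i : mprime A G) (j : mprime A H) : rmap s i (0 : F (mpobj j)) = 0.
Proof. exact: fext0. Qed.

Lemma rmapD (G H : gobj C) (s : mpair A (gtype G * gtype H)%type)
    (i : mprime A G) (j : mprime A H) : {morph rmap s i (j := j) : y z / y + z}.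
Proof. by move=> y z; exact: fextD. Qed.

Lemma term_linear (G H : gobj C) (s : mpair A (gtype G * gtype H)%type)
    (i : mprime A G) r (x y : plus_mod F H) :
  term s i (r *: x + y) = r *: term s i x + term s i y.
Proof.
rewrite /term; case: pselect => [e|_]; last by rewrite scaler0 addr0.
by rewrite rmapD /rmap fextZ.
Qed.

(** * The map F^+([U]) for a fibered biset U *)

Section Biset.
Variables (G H : gobj C) (U : biset A G H).

Lemma term_orb (u v : U) i (x : plus_mod F H) :
  orb u v -> term (stab_pair u) i x = term (stab_pair v) i x.
Proof.
move=> [h Hh [a ->]]; rewrite stab_fact ?mem_setX1r //.
by rewrite -(term_mconjr (stab_pair u) i x Hh).
Qed.

Definition plusU_fun (x : plus_mod F H) (i : mprime A G) : F (mpobj i) :=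
  \sum_(u \in (reps U : set {classic U})) term (stab_pair (u : U)) i x.

Lemma plusU_funE (X : set U) x i : orb_reps X ->
  plusU_fun x i =
  \sum_(u \in (X : set {classic U})) term (stab_pair (u : U)) i x.
Proof.
move=> rX; apply: (orbit_sum_indep (repsP U) rX) => u v; exact: term_orb.
Qed.

Lemma transports_uniql (gT hT : finGroupType) (s : mpair A (gT * hT)%type)
    i i' j : mdom i = mdom i' -> transports s i j -> transports s i' j -> i = i'.
Proof.
move=> e [i1 i2 i3 i4] [j1 j2 j3 j4]; apply: mpair_eqP => // g ig.
by have [h sgh] := i1 g ig; rewrite (i4 g h) // (j4 g h) // -e.
Qed.

(** The index set M'(G) can be infinite. A nonzero component at i requires a representative u and an
    index j in the support of x, and i is recovered from its subgroup, u and j; there are finitely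
    many such triples. *)
Lemma plusU_supp x : plus_supp (plusU_fun x).
Proof.
pose B := [set: {group gtype G}] `*` (reps U `*` [set j : mprime A H | x j <> 0]).
pose r (t : {group gtype G} * (U * mprime A H)) (i : mprime A G) :=
  mdom i = t.1 /\ good (stab_pair t.2.1) i t.2.2.
have fB : finite_set B.
  apply: finite_setX; first exact: finite_finset.
  by apply: finite_setX; [exact: finite_reps (repsP U)|exact: plus_suppP].
apply: sub_finite_set (finite_functional (r := r) fB _) => [i yi|]; last first.
  move=> t i i' _ [ti [gi _]] [ti' [gi' _]]; apply: mprime_inj.
  by apply: (transports_uniql _ gi gi'); rewrite ti ti'.
apply: contrapT => n; apply: yi; apply: fsbig1 => u Xu.
have [[j uij]|nj] := pselect (exists j, good (stab_pair (u : U)) i j); last first.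
  by apply: term0 => j uij; apply: nj; exists j.
rewrite (termE _ uij); have [->|xj] := pselect (x j = 0); first exact: rmap0.
by case: n; exists (mdom i, (u, j)).
Qed.

(** Acting by (g, 1) permutes the (A, H)-orbits of U and conjugates the stabilizing pairs, so the
    summands at i and at its conjugate correspond. *)
Lemma plusU_equiv x : plus_equiv (plusU_fun x).
Proof.
move=> g i j Gg ji; have Gg1 := mem_setX1l H Gg.
have -> : fext F
    (conj_class A R g (mdom j) (mdom i) : BAR A R (mpobj j) (mpobj i))
    (plusU_fun x i) = rmap (cpair A g (mdom i)) j (plusU_fun x i).
  by rewrite /rmap mrestr_cpair // ji mkpair_dom.
rewrite /plusU_fun (fsbig_morph _ (finite_reps_classic U)
  (@rmap0 _ _ _ _ _)); last first.
  exact: rmapD.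
apply/esym.
apply: (orbit_sum_map (f := fact (g, 1%g) 1%g)) (repsP U) (repsP U) _ _ _ _.
- move=> u u'; split=> -[h Hh [a e]]; exists h => //; exists a.
    by rewrite e -!factM ?mem_setX1r // !pairM !mul1g !mulg1.
  apply: (@fact_inj _ _ _ _ _ 1%g Gg1); rewrite e.
  by rewrite -!factM ?mem_setX1r // !pairM !mul1g !mulg1.
- move=> v; have Gg1' : (g^-1, 1%g)%g \in setX_group G H.
    by rewrite mem_setX1l ?groupV.
  exists (fact (g^-1, 1)%g 1%g v).
  by rewrite -factM // pairM mulgV !mulg1 fact1; exact: orb_refl.
- by move=> v v'; exact: term_orb.
- move=> u; rewrite stab_fact //; apply/esym.
  exact: term_mconjl.
Qed.

Definition plusU (x : plus_mod F H) : plus_ob F G :=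
  PlusMod (plusU_supp x) (plusU_equiv x).

Lemma plusU_linear : linear plusU.
Proof.
move=> r x y; apply: plus_modP => i.
have fX := finite_reps_classic U.
rewrite /= /plusU_fun !(fsbig_finite _ _ fX).
under eq_bigr do rewrite term_linear.
by rewrite big_split /= scaler_sumr.
Qed.

End Biset.

Lemma plusU_iso (G H : gobj C) (U V : biset A G H) x :
  fiso U V -> plusU U x = plusU V x.
Proof.
move=> [f fB fE]; have fI := bij_inj fB; apply: plus_modP => i.
apply: (orbit_sum_map (f := f)) (repsP U) (repsP V) _ _ _ _.
- by move=> u u'; exact: orb_equivariant.
- by have [f' _ f'K] := fB; move=> v; exists (f' v); rewrite f'K; exact: orb_refl.
- by move=> v v'; exact: term_orb.
- by move=> u; rewrite (stab_equivariant u fE fI).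
Qed.

Lemma plusU_sum (G H : gobj C) (U V : biset A G H) x :
  plusU (fib_sum U V : biset A G H) x = plusU U x + plusU V x.
Proof.
apply: plus_modP => i; set W : biset A G H := fib_sum U V.
pose l (u : {classic U}) : {classic W} := inl u.
pose r (v : {classic V}) : {classic W} := inr v.
have lE : equivariant (l : U -> W) by [].
have rE : equivariant (r : V -> W) by [].
have lI : injective l by move=> ? ? [].
have rI : injective r by move=> ? ? [].
have [U1 U2] := repsP U; have [V1 V2] := repsP V.
rewrite [LHS](plusU_funE (X := (l @` reps U) `|` (r @` reps V))); last first.
  split=> [[w|w]|w w' [[u Xu <-]|[u Xu <-]] [[v Xv <-]|[v Xv <-]]].
  - have [u Xu uw] := U1 w; exists (l u); first by left; exists u.
    exact/(orb_equivariant _ _ lE lI).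
  - have [u Xu uw] := V1 w; exists (r u); first by right; exists u.
    exact/(orb_equivariant _ _ rE rI).
  - by move/(orb_equivariant _ _ lE lI) => uv; rewrite (U2 u v).
  - by move=> [h _ [a]].
  - by move=> [h _ [a]].
  - by move/(orb_equivariant _ _ rE rI) => uv; rewrite (V2 u v).
rewrite fsbigU0; last 3 first.
- exact/finite_image/finite_reps_classic.
- exact/finite_image/finite_reps_classic.
- by move=> _ [[u _ <-] [v _]].
rewrite (@fsbig_image _ _ _ {classic U} {classic W} (reps U) l); last first.
  by move=> ? ? _ _ [].
rewrite (@fsbig_image _ _ _ {classic V} {classic W} (reps V) r); last first.
  by move=> ? ? _ _ [].
by congr (_ + _); apply: eq_fsbigr => u _; rewrite stab_equivariant.
Qed.

(** * Compatibility with tensor products and identities *)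

Section Tensor.
Variables (G H K : gobj C) (U : biset A G H) (V : biset A H K).
Hypothesis SU : forall u : U, splus C S G H (stab_pair u).
Hypothesis SV : forall v : V, splus C S H K (stab_pair v).

Let k2U (u : U) : ker2 (mdom (stab_pair u)) = [set 1%g]%SET.
Proof. by have [_ C1 C2 Su] := SU u; exact: S_k2 C1 C2 Su. Qed.

Let compUV (u : U) (v : V) : compat (stab_pair u) (stab_pair v) :=
  compat_trivl (k2U u).

Definition tpt (u : U) (v : V) : tensor U V :=
  tpoint (compat_torbit_free (@compUV u v)).

Lemma stab_tpt u v : stab_pair (tpt u v) = mstar (stab_pair u) (stab_pair v).
Proof. by rewrite (stab_tensor (u := u) (v := v)). Qed.

Lemma tpt_surj (c : tensor U V) :
  exists u v, [/\ reps U u, reps V v & orb (tpt u v) c].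
Proof.
have [u' [v' [cE _]]] := svalP c.
have [u Xu [h Hh [a u'E]]] := (repsP U).1 u'.
(* As u' = (1, h) a u, both h and a can be moved across the tensor product; the representative v is
   taken for the element of V obtained in this way. *)
have [v Yv [k Kk [b vE]]] := (repsP V).1 (fact (h^-1, 1)%g a v').
exists u, v; split=> //; exists k => //; exists b; apply: tens_car_inj.
rewrite (tens_actE2 (u := u) (v := v)) ?group1 // cE.
have -> : torbit u' v' = torbit u (fact (h^-1, 1)%g a v').
  apply/esym/torbit_eq/mem_torbit; exists h => //; exists a; split=> //.
  by rewrite u'E -factM ?mem_setX1r ?groupV // pairM mulg1 !mulVg fact1.
rewrite vE; apply: torbit_eq; exists 1%g; rewrite ?group1 //; exists b.
by rewrite -!factM ?mem_setX1r ?group1 // !pairM !mul1g (mulVg b) mulg1 fact1.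
Qed.

Lemma tpt_inj u v u1 v1 : reps U u -> reps V v -> reps U u1 -> reps V v1 ->
  orb (tpt u v) (tpt u1 v1) -> u = u1 /\ v = v1.
Proof.
move=> Xu Yv Xu1 Yv1 [k Kk [a /(congr1 sval)]].
rewrite [RHS](tens_actE2 (u := u) (v := v)) ?group1 // => e.
have : torbit (fact (1, 1)%g a u) (fact (1, k)%g 1%g v) (u1, v1).
  by rewrite -e; exact: torbit_refl.
move=> [h Hh [b [u1E v1E]]].
have Gh := mem_setX1r G Hh.
have {}u1E : u1 = fact (1, h)%g (b^-1 * a)%g u.
  by rewrite u1E -factM ?group1 // pairM !mulg1.
have uu1 : u = u1.
  by apply: (repsP U).2 => //; exists h => //; exists (b^-1 * a)%g.
split=> //.
(* With u = u1, the element (1, h) scales u; triviality of k_2 gives h = 1, so v1 is in the orbit of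
   v. *)
have hk : h \in ker2 (mdom (stab_pair u)).
  rewrite inE; apply/mem_stabP; split=> //; exists (b^-1 * a)^-1%g.
  rewrite [in RHS]uu1 u1E -factM ?group1 // mulVg.
  by congr fact; rewrite pairM !mul1g.
apply: (repsP V).2 => //; exists k => //; exists b.
move: hk; rewrite k2U inE => /eqP h1.
by rewrite v1E h1 -factM ?mem_setX1r ?group1 // mul1g mulg1.
Qed.

Lemma plusU_tensor x :
  plusU (tensor U V : biset A G K) x = plusU U (plusU V x).
Proof.
apply: plus_modP => i.
have fU := finite_reps_classic U; have fV := finite_reps_classic V.
have tE (u : U) : term (stab_pair u) i (plusU V x) =
    \sum_(v \in (reps V : set {classic V}))
      term (mstar (stab_pair u) (stab_pair (v : V))) i x.
  (* If u contributes at i, all inner terms pass through the same j; if not, both sides vanish. *)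
  have [[j uij]|n] := pselect (exists j, good (stab_pair u) i j).
    rewrite (termE _ uij) [LHS](fsbig_morph _ fV (@rmap0 _ _ _ _ _)).
      apply: eq_fsbigr => v _; apply/esym.
      by apply: term_mstar => //; exact: k2U.
    exact: rmapD.
  rewrite term0 => [|j uij]; last by apply: n; exists j.
  rewrite fsbig1 // => v _; apply: term_mstar0 => //.
  by move=> j uij; apply: n; exists j.
transitivity (\sum_(u \in (reps U : set {classic U}))
    \sum_(v \in (reps V : set {classic V}))
      term (mstar (stab_pair (u : U)) (stab_pair (v : V))) i x); last first.
  by apply: eq_fsbigr => u _; rewrite tE.
rewrite pair_fsbig //.
apply/esym; apply: (@fsbig_match _ ({classic U} * {classic V})%type
  {classic (tensor U V)} ((reps U : set {classic U}) `*` (reps V : set {classic V}))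
  (reps (tensor U V)) (fun w c => orb (tpt w.1 w.2) c)
  (fun w => term (mstar (stab_pair (w.1 : U)) (stab_pair (w.2 : V))) i x)
  (fun c => term (stab_pair (c : tensor U V)) i x)).
- move=> [u v] _; have [c Zc cw] := (repsP (tensor U V)).1 (tpt u v).
  by exists c => //; exact: orb_sym.
- by move=> c _; have [u [v [Xu Yv uvc]]] := tpt_surj c; exists (u, v).
- move=> w c c' _ Zc Zc' wc wc'; apply: (repsP _).2 => //.
  exact: orb_trans (orb_sym wc) wc'.
- move=> [u v] [u' v'] c [Xu Yv] [Xu' Yv'] _ wc w'c.
  by have [/= -> ->] := tpt_inj Xu Yv Xu' Yv' (orb_trans wc (orb_sym w'c)).
- by move=> [u v] c _ _ wc; rewrite -(term_orb _ _ wc) stab_tpt.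
Qed.

End Tensor.


(** Over [mdom i] the diagonal of G is the conjugation graph of 1, so the claim is the equivariance
    of x at g = 1. *)
Lemma term_id (G : gobj C) (i : mprime A G) (x : plus_mod F G) :
  term (mtriv A (diag_group G)) i x = x i.
Proof.
have ii : mppair i = mconj 1%g i by rewrite mconj1.
have e : mrestr (mdom i) (cpair A 1%g (mdom i)) =
    mrestr (mdom i) (mtriv A (diag_group G)).
  rewrite mrestr_cpair ?invg1 ?conjsg1 //; apply: mpair_ext => -[a b].
    rewrite mem_mrestr (mem_cpair A) invg1 conjg1 /=.
    apply/andP/andP => [[ib /eqP ->]|[/diagP[/= _ ->] ia]]; last by rewrite eqxx.
    by split=> //; apply/diagP; split=> //; exact: (fintype.subsetP (mpsub i)).
  rewrite (mem_cpair A) invg1 conjg1 => /andP[ib /eqP ->].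
  by rewrite mrestr_chi // !mtriv_chi.
have gc := good_cpair (group1 G) ii.
rewrite (termE _ (good_mrestr e gc)) -[RHS](rmap_cpair x (group1 G) ii).
by rewrite /rmap e.
Qed.

Lemma plusU_id (G : gobj C) (x : plus_mod F G) :
  plusU (transitive_set (setX_group G G) (mtriv A (diag_group G)) : biset A G G) x
  = x.
Proof.
apply: plus_modP => i; set T : biset A G G := transitive_set _ _.
have dG : mdom (mtriv A (diag_group G)) \subset setX_group G G.
  by apply/fintype.subsetP => -[a b] /diagP[/= Ga ->]; rewrite inE /= Ga.
pose b : T := tbase _ _.
rewrite [LHS](plusU_funE (X := [set b])).
  by rewrite (@fsbig_set1 _ _ _ {classic T}) stab_tbase // term_id.
split=> [v|_ _ -> -> //]; exists b => //.
have [[g h] /setXP[Gg Gh] [a ->]] := tbase_transitive v.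
(* The element (g, g) fixes the base point b, so (g, h) b = (1, h g^-1) b and there is a single
   orbit. *)
exists (h * g^-1)%g; first by rewrite groupM ?groupV.
exists a; have gg : (g, g) \in mdom (stab_pair b).
  by rewrite stab_tbase //; apply/diagP.
have := stabE gg; rewrite stab_tbase // mtriv_chi fact1 => bE.
rewrite -[in RHS]bE -factM ?inE /= ?Gg ?groupM ?groupV ?group1 //.
by rewrite pairM mul1g mulgKV mulg1.
Qed.

(** * Linear extension and functoriality of F^+ *)

Definition plusF (G H : gobj C) (f : BAR A R G H) (x : plus_ob F H) :
  plus_ob F G := groth_lift (fun U : biset A G H => plusU U x) f.

Lemma plusF_invariant (G H : gobj C) x : groth_invariant
  (@fiso A _ (setX_group G H)) (@fib_sum A _ (setX_group G H))
  (fun U : biset A G H => plusU U x : plus_ob F G).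
Proof. by split=> U V; [exact: plusU_iso|exact: plusU_sum]. Qed.

Lemma plusF_bclass (G H : gobj C) (U : biset A G H) x :
  plusF (bclass R U) x = plusU U x.
Proof. exact: (groth_lift_gen (@plusF_invariant G H x)). Qed.

Lemma plusF_linearl (G H : gobj C) x : linear (fun f : BAR A R G H => plusF f x).
Proof. exact: (groth_lift_linear (@plusF_invariant G H x)). Qed.

Lemma plusF_linearr (G H : gobj C) (f : BAR A R G H) : linear (plusF f).
Proof.
move=> r x y; rewrite /plusF /groth_lift scaler_sumr -big_split.
apply: eq_bigr => c _ /=.
by rewrite [plusU _ _]plusU_linear scalerDr !scalerA mulrC.
Qed.

Lemma linear_fun0 (M N : lmodType R) (f : M -> N) : linear f -> f 0 = 0.
Proof. by move=> fl; have := fl (-1) 0 0; rewrite scaler0 addr0 scaleN1r addNr. Qed.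

Lemma splus_transitive (G H : gobj C) p : splus C S G H p ->
  forall u : transitive_set (setX_group G H) p, splus C S G H (stab_pair u).
Proof.
move=> Sp u; have [[g h] GHgh [a ->]] := tbase_transitive u.
have [pGH _ _ _] := Sp; have /setXP[Gg Hh] := GHgh.
by rewrite stab_fact // stab_tbase //; exact: splus_mconj2 Gg Hh Sp.
Qed.

(** Bilinearity reduces the claim to transitive classes of pairs in S^+, whose stabilizing pairs are
    conjugates and hence again in S^+. The composite itself may leave the span, but [plusF] is
    defined there too. *)
Lemma plusF_comp (G H K : gobj C) f g x :
  homs R (splus C S) G H f -> homs R (splus C S) H K g ->
  plusF (bcomp f g) x = plusF f (plusF g x).
Proof.
move=> Sf Sg; elim/Rspan_ind: {f} Sf => [|r _ f [p Sp <-] IH].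
  rewrite (linear_fun0 (bcomp_linearl g)).
  by rewrite !(linear_fun0 (plusF_linearl _)).
rewrite (bcomp_linearl g) !plusF_linearl IH; congr (r *: _ + _).
elim/Rspan_ind: {g IH} Sg => [|r' _ g [q Sq <-] IH].
  rewrite (linear_fun0 (bcomp_linearr _)) !(linear_fun0 (plusF_linearl _)).
  by rewrite (linear_fun0 (plusF_linearr _)).
rewrite bcomp_linearr !plusF_linearl plusF_linearr IH; congr (r' *: _ + _).
rewrite /trclass bcomp_class !plusF_bclass.
by apply: plusU_tensor; exact: splus_transitive.
Qed.

HB.instance Definition _ (G H : gobj C) (f : BAR A R G H) :=
  GRing.isLinear.Build R (plus_ob F H) (plus_ob F G) _ (plusF f) (plusF_linearr f).

Definition plus_functor_on : functor_on (homs R (splus C S)) (plus_ob F).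
Proof.
exists (fun G H f => plusF (sval f) : {linear plus_ob F H -> plus_ob F G}).
- by move=> G H r f g h /= -> x; exact: plusF_linearl.
- by move=> G f /= -> x; rewrite plusF_bclass plusU_id.
- by move=> G H K f g h /= -> x; apply: plusF_comp; exact: svalP.
Defined.

(** For pairs in S^+, [contributes] and [good] coincide. Discarding the u without a contribution
    removes only zeros, and each remaining u has exactly one partner lambda. *)
Lemma plusU_formula (G H : gobj C) (U : biset A G H) (X : set U) x i :
  (forall u : U, splus C S G H (stab_pair u)) -> orbit_reps X ->
  plusU U x i = plus_formula X (x : plus_ob F H) i.
Proof.
move=> SU /orbit_reps_orb rX; rewrite [LHS](plusU_funE _ _ rX).
have ctr (u : U) j : contributes i u j <-> good (stab_pair u) i j.
  split=> [/transportsP uij|[uij _]]; last exact/transportsP.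
  have [j' j'j gij'] := splus_good (SU u) uij.
  by rewrite -(mprime_inj j'j).
pose X' := (X : set {classic U}) `&`
  [set u | exists j, good (stab_pair (u : U)) i j].
rewrite -(fsbig_widen X'); first last.
- move=> u [Xu nu] /=; apply: term0 => j uij; apply: nu; split=> //; by exists j.
- by move=> u [].
apply: (@fsbig_match _ {classic U} ({classic U} * {classic (mprime A H)})%type
  X' _ (fun u w => u = w.1)).
- move=> u [Xu [j uij]]; exists (u, j) => //; split=> //; exact/ctr.
- move=> [u j] [/= Xu /ctr uij]; exists u => //; split=> //; by exists j.
- move=> u [v j] [v' j'] _ [/= _ /ctr vj] [/= _ /ctr vj'] /= uv uv'.
  rewrite -uv -uv' in vj vj' *; congr pair; exact: good_uniq vj vj'.
- by move=> u u' w _ _ _ -> ->.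
- by move=> u [v j] _ [/= _ /ctr vj] /= ->; rewrite (termE _ vj).
Qed.

End Functor.

(** * Natural transformations *)

Section Natural.
Variables (F F' : functor (homs R S : homfam A R C)) (phi : nattrans F F').

Lemma nattrans_fext (G H : gobj C) f (x : F H) :
  phi G (fext F f x) = fext F' f (phi H x).
Proof. by rewrite /fext; case: pselect => [Df|_]; [exact: ntP|exact: linear0]. Qed.

Definition nplus_fun (G : gobj C) (x : plus_ob F G) : plus_ob F' G.
Proof.
exists (fun i => phi (mpobj i) ((x : plus_mod F G) i)).
  apply: sub_finite_set (plus_suppP x) => i /= + xi0.
  by rewrite xi0 linear0.
by move=> g i j Gg ji; rewrite (plus_equivP x Gg ji) nattrans_fext.
Defined.

Lemma nplus_linear (G : gobj C) : linear (@nplus_fun G).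
Proof. by move=> r x y; apply: plus_modP => i /=; rewrite linearP. Qed.

HB.instance Definition _ (G : gobj C) :=
  GRing.isLinear.Build R (plus_ob F G) (plus_ob F' G) _ (@nplus_fun G)
    (@nplus_linear G).

(** The index chosen in [term] depends on s and i but not on the functor, so naturality at a single
    morphism is enough. *)
Lemma nplus_term (G H : gobj C) (s : mpair A (gtype G * gtype H)%type) i
    (x : plus_mod F H) :
  phi (mpobj i) (term s i x) = term s i (nplus_fun x : plus_mod F' H).
Proof.
rewrite /term; case: pselect => [e|_]; last exact: linear0.
exact: nattrans_fext.
Qed.

Lemma nplus_plusU (G H : gobj C) (U : biset A G H) x :
  nplus_fun (plusU U x) = plusU U (nplus_fun x).
Proof.
apply: plus_modP => i /=.
rewrite [LHS](fsbig_morph _ (finite_reps_classic U)) ?linear0 //;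
  last exact: linearD.
by apply: eq_fsbigr => u _; rewrite nplus_term.
Qed.

Lemma nplus_plusF (G H : gobj C) (f : BAR A R G H) x :
  nplus_fun (plusF f x) = plusF f (nplus_fun x).
Proof.
rewrite /plusF /groth_lift linear_sum; apply: eq_bigr => c _.
by rewrite linearZ /= nplus_plusU.
Qed.

Definition nplus :
  nattrans (Functor (plus_functor_on F)) (Functor (plus_functor_on F')).
Proof.
exists (fun G => @nplus_fun G : {linear plus_ob F G -> plus_ob F' G}).
by move=> G H f x; exact: nplus_plusF.
Defined.

End Natural.

End Terms.

Theorem theorem5p5 (A : abGroupType) (R : comPzRingType)
    (C : group_class) (S : pair_family A)
    (S_wf : family_wf C S)
    (S_i : axiom_i C S) (S_ii : axiom_ii C S) (S_iii : axiom_iii C S)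
    (S_vii : axiom_vii C S) (S_viii : axiom_viii C S)
    (S_k2 : forall (gT hT : finGroupType) (G : {group gT}) (H : {group hT})
        (p : mpair A (gT * hT)%type),
      C gT G -> C hT H -> S gT hT G H p -> ker2 (mdom p) = [set 1%g]%SET) :
  let D : homfam A R C := homs R S in
  let Dplus : homfam A R C := homs R (splus C S) in
  exists (Fplus : forall F : functor D, functor_on Dplus (plus_ob F)),
  let plus (F : functor D) : functor Dplus := Functor (Fplus F) in
  exists (nplus : forall F F' : functor D,
            nattrans F F' -> nattrans (plus F) (plus F')),
  [/\ (forall (F : functor D) (G H : gobj C) (U : biset A G H),
         (forall u : U, splus C S G H (stab_pair u)) ->
         exists2 f : fhom Dplus G H, sval f = bclass R U &
           forall (X : set U), orbit_reps X ->
           forall (x : plus_ob F H) (i : mprime A G),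
             fmap (plus F) f x i = plus_formula X x i),
      (forall (F F' : functor D) (phi : nattrans F F') (G : gobj C)
          (x : plus_ob F G) (i : mprime A G),
         nplus F F' phi G x i = phi (mpobj i) (x i)),
      (forall F : functor D, nplus F F (nat_id F) = nat_id (plus F)),
      (forall (F F' F'' : functor D)
          (psi : nattrans F' F'') (phi : nattrans F F'),
         nplus F F'' (nat_comp psi phi) =
         nat_comp (nplus F' F'' psi) (nplus F F' phi)) &
      (forall (F F' : functor D) (r : R) (phi psi : nattrans F F'),
         nplus F F' (nat_lin r phi psi) =
         nat_lin r (nplus F F' phi) (nplus F F' psi))].
Proof.
move=> D Dplus.
exists (plus_functor_on S_wf S_i S_ii S_iii S_vii S_viii S_k2) => plus.
exists (nplus S_wf S_i S_ii S_iii S_vii S_viii S_k2); split.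
- move=> F G H U SU.
  have DU : Dplus G H (bclass R U).
    by apply: bclass_span => u; exists (stab_pair u).
  exists (exist _ _ DU) => // X rX x i.
  rewrite -(plusU_formula S_wf S_i S_ii S_iii S_vii S_viii x i SU rX).
  by rewrite -plusF_bclass.
- by [].
- by move=> F; apply: nattransP => G x; apply: plus_modP.
- by move=> F F' F'' psi phi; apply: nattransP => G x; apply: plus_modP.
- by move=> F F' r phi psi; apply: nattransP => G x; apply: plus_modP.
Qed.
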